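(* A countable branch group is either amenable or $C^\ast$-simple.
   Context: Let $r=(r_1,r_2,\dots)$ be an infinite sequence of integers $r_i\ge2$ and $T_r$ the spherically homogeneous rooted tree with degree sequence $r$ (every vertex at distance $i-1$ from the root has $r_i$ neighbours at distance $i$ from the root). The $n$-th level is the set of vertices at distance $n$ from the root. $\mathrm{Aut}(T_r)$ is the group of automorphisms fixing the root. A subgroup $G\le\mathrm{Aut}(T_r)$ is level-transitive if it acts transitively on every level. $\mathrm{St}_G(n)$ is the pointwise stabilizer of the $n$-th level. The subtree below a vertex $v$ is spanned by all vertices $w$ such that the geodesic from $w$ to the root passes through $v$; $\mathrm{RiSt}_G(v)$ is the subgroup of elements of $G$ fixing $v$ and acting trivially outside the subtree below $v$; $\mathrm{RiSt}_G(n)$ is the subgroup of $\mathrm{St}_G(n)$ generated by the $\mathrm{RiSt}_G(v)$ for $v$ in the $n$-th level. A subgroup $G\le\mathrm{Aut}(T_r)$ is a branch group if $G$ is level-transitive and $\mathrm{RiSt}_G(n)$ has finite index in $\mathrm{St}_G(n)$ for every $n\ge1$. A group is $C^\ast$-simple if its reduced $C^\ast$-algebra is simple. *)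

(* Defs.v *)
From HB Require Import structures.
From mathcomp Require Import all_boot all_order all_algebra.
From mathcomp Require Import complex ring lra.
From mathcomp Require Import all_classical all_reals all_analysis.

Set Implicit Arguments.
Unset Strict Implicit.
Unset Printing Implicit Defensive.

Import Order.TTheory GRing.Theory Num.Theory.
Local Open Scope classical_set_scope.
Local Open Scope ring_scope.
Local Open Scope complex_scope.

(* A vertex at distance [n] from the root is a word [x_0 ... x_(n-1)] with
   [x_i < r i], so [r i] is the number of children of a vertex of level [i]:
   the degree sequence [(r_1, r_2, ...)] is indexed from 0 here. *)
Definition is_vertex (r : nat -> nat) (s : seq nat) : bool :=
  [forall i : 'I_(size s), nth 0%N s i < r i]%N.

Definition vertex (r : nat -> nat) := {s : seq nat | is_vertex r s}.

Definition level (r : nat -> nat) (n : nat) : set (vertex r) :=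
  [set v | size (val v) = n].

Lemma is_vertex_nil (r : nat -> nat) : is_vertex r [::].
Proof. by apply/forallP => -[]. Qed.

Definition root (r : nat -> nat) : vertex r :=
  exist _ [::] (is_vertex_nil r).

Definition is_child (r : nat -> nat) (u v : vertex r) : Prop :=
  exists x, val v = rcons (val u) x.

Definition adjacent (r : nat -> nat) (u v : vertex r) : Prop :=
  is_child u v \/ is_child v u.

Definition is_tree_aut (r : nat -> nat) (f : vertex r -> vertex r) : Prop :=
  [/\ bijective f, forall u v, adjacent u v <-> adjacent (f u) (f v)
    & f (root r) = root r].

Record tree_aut (r : nat -> nat) := TreeAut {
  aut_fun :> vertex r -> vertex r;
  aut_funP : is_tree_aut aut_fun }.

Section TreeAutGroup.
Variable r : nat -> nat.

HB.instance Definition _ := gen_eqMixin (tree_aut r).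
HB.instance Definition _ := gen_choiceMixin (tree_aut r).

Lemma tree_aut_eq (f g : tree_aut r) : f =1 g -> f = g.
Proof.
case: f g => f fP [g gP] /= /funext fg; subst g.
by congr TreeAut; exact: Prop_irrelevance.
Qed.

Lemma id_is_tree_aut : is_tree_aut (@id (vertex r)).
Proof. by split=> //; exists id. Qed.

Lemma comp_is_tree_aut (f g : tree_aut r) : is_tree_aut (f \o g).
Proof.
case: f g => f [fb fa fr] [g [gb ga gr]] /=; split; first exact: bij_comp.
- by move=> u v; rewrite ga fa.
- by rewrite /= gr fr.
Qed.

Lemma inv_tree_aut_ex (f : tree_aut r) :
  exists g : tree_aut r, cancel f g /\ cancel g f.
Proof.
case: f => f [[g fK gK] fa fr].
have gP : is_tree_aut g.
  split; first by exists f.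
  - by move=> u v; have := fa (g u) (g v); rewrite !gK => ->.
  - by rewrite -fr fK.
by exists (TreeAut gP).
Qed.

Definition tree_aut_one : tree_aut r := TreeAut id_is_tree_aut.
Definition tree_aut_mul (f g : tree_aut r) : tree_aut r :=
  TreeAut (comp_is_tree_aut f g).
Definition tree_aut_inv (f : tree_aut r) : tree_aut r :=
  projT1 (cid (inv_tree_aut_ex f)).

Lemma tree_aut_mulA : associative tree_aut_mul.
Proof. by move=> f g h; exact: tree_aut_eq. Qed.
Lemma tree_aut_mul1g : left_id tree_aut_one tree_aut_mul.
Proof. by move=> f; exact: tree_aut_eq. Qed.
Lemma tree_aut_mulg1 : right_id tree_aut_one tree_aut_mul.
Proof. by move=> f; exact: tree_aut_eq. Qed.
Lemma tree_aut_mulVg : left_inverse tree_aut_one tree_aut_inv tree_aut_mul.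
Proof.
move=> f; apply: tree_aut_eq => v; rewrite /tree_aut_inv /=.
by case: cid => g [fK gK] /=.
Qed.
Lemma tree_aut_mulgV : right_inverse tree_aut_one tree_aut_inv tree_aut_mul.
Proof.
move=> f; apply: tree_aut_eq => v; rewrite /tree_aut_inv /=.
by case: cid => g [fK gK] /=.
Qed.

HB.instance Definition _ := isGroup.Build (tree_aut r)
  tree_aut_mulA tree_aut_mul1g tree_aut_mulg1 tree_aut_mulVg tree_aut_mulgV.

End TreeAutGroup.

Definition subgroup_type (gT : groupType) (G : groupClosed gT) :=
  {x : gT | x \in G}.

Section SubgroupType.
Variables (gT : groupType) (G : groupClosed gT).

Lemma groupClosed_group_closed : group_closed G.
Proof. by split=> [|x y xG yG]; [exact: gpred1 | exact: gpredF]. Qed.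

HB.instance Definition _ := SubChoice.on (subgroup_type G).
HB.instance Definition _ := SubChoice_isSubGroup.Build gT _ (subgroup_type G)
  groupClosed_group_closed.

End SubgroupType.

Definition generated (gT : groupType) (A : set gT) : set gT :=
  smallest [set H : set gT | group_closed (mem H)] A.

(* Finitely many left cosets [x H] with [x] in [K]; [H] is meant to be a
   subgroup of the subgroup [K]. *)
Definition finite_index (gT : groupType) (H K : set gT) : Prop :=
  finite_set [set [set (x * h)%g | h in H] | x in K].

Section Branch.
Variables (r : nat -> nat) (G : groupClosed (tree_aut r)).

Definition level_transitive : Prop :=
  forall n (u v : vertex r), level n u -> level n v ->
    exists2 g : tree_aut r, g \in G & g u = v.

Definition St (n : nat) : set (tree_aut r) :=
  [set g | g \in G /\ forall v, level n v -> g v = v].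

(* The path from [w] to the root consists of the prefixes of [w]. *)
Definition subtree (v : vertex r) : set (vertex r) :=
  [set w | prefix (val v) (val w)].

Definition RiSt_vertex (v : vertex r) : set (tree_aut r) :=
  [set g | [/\ g \in G, g v = v & forall w, ~ subtree v w -> g w = w]].

Definition RiSt (n : nat) : set (tree_aut r) :=
  generated (\bigcup_(v in level n) RiSt_vertex v).

Definition branch_group : Prop :=
  level_transitive /\
  forall n, (1 <= n)%N -> finite_index (RiSt n) (St n).

End Branch.

(* von Neumann's definition, for discrete groups: a left-invariant finitely
   additive probability measure on all subsets. *)
Definition amenable (R : realType) (gT : groupType) : Prop :=
  exists mu : set gT -> R,
    [/\ mu setT = 1,
        forall A, 0 <= mu A,
        forall A B, A `&` B = set0 -> mu (A `|` B) = mu A + mu B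
      & forall g A, mu [set (g * x)%g | x in A] = mu A].

Section L2.
Variables (R : realType) (gT : groupType).

Definition sqnorm_sum (xi : gT -> R[i]) : \bar R :=
  (\esum_(g in [set: gT]) (Normc.normc (xi g) ^+ 2)%:E)%E.

Definition sq_summable : {pred gT -> R[i]} :=
  [pred xi | `[< (sqnorm_sum xi < +oo)%E >]].

Lemma sq_summableP (xi : gT -> R[i]) :
  reflect (sqnorm_sum xi < +oo)%E (xi \in sq_summable).
Proof. exact: asboolP. Qed.

Lemma sqnorm_sum_pZ (f : gT -> R[i]) (c : R) : 0 < c ->
  (\esum_(g in [set: gT]) (c * Normc.normc (f g) ^+ 2)%:E =
   c%:E * sqnorm_sum f)%E.
Proof.
move=> c0; rewrite /sqnorm_sum /esum -ereal_sup_pZl//; congr ereal_sup.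
rewrite image_comp; apply: eq_imagel => A [finA _] /=.
rewrite !fsbig_finite//= ge0_sume_distrr// => g _.
by rewrite lee_fin sqr_ge0.
Qed.

Lemma normc_sqr_lin (a x y : R[i]) :
  Normc.normc (a * x + y) ^+ 2 <=
  (2 * Normc.normc a ^+ 2 + 1) * Normc.normc x ^+ 2 + 2 * Normc.normc y ^+ 2.
Proof.
have E (z : R[i]) :
    Normc.normc z ^+ 2 = complex.Re z ^+ 2 + complex.Im z ^+ 2.
  by case: z => b c; rewrite /= sqr_sqrtr// addr_ge0 ?sqr_ge0.
rewrite mulrDl -mulrA -exprMn -Normc.normcM mul1r.
apply: (@le_trans _ _ (2 * Normc.normc (a * x) ^+ 2 + 2 * Normc.normc y ^+ 2)).
  move: (a * x) y => [x1 x2] [y1 y2]; rewrite !E /=.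
  rewrite -subr_ge0 [leRHS](_ : _ = (x1 - y1) ^+ 2 + (x2 - y2) ^+ 2).
    by rewrite addr_ge0 ?sqr_ge0.
  by ring.
by rewrite lerD2r lerDl sqr_ge0.
Qed.

Lemma sq_summable_submod : submod_closed sq_summable.
Proof.
split=> [|a x y].
  apply/sq_summableP.
  rewrite /sqnorm_sum esum1 ?ltry// => g _.
  by rewrite [Normc.normc _](@Normc.normc0 R) expr0n.
move=> /sq_summableP xs /sq_summableP ys; apply/sq_summableP.
set c := 2 * Normc.normc a ^+ 2 + 1.
have c0 : 0 < c by rewrite ltr_wpDl// mulr_ge0// sqr_ge0.
apply: (@le_lt_trans _ _ (c%:E * sqnorm_sum x + 2%:E * sqnorm_sum y)%E).
  rewrite -!sqnorm_sum_pZ// -esumD => [|g _|g _]; last 2 first.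
  - by rewrite lee_fin mulr_ge0 ?sqr_ge0// ltW.
  - by rewrite lee_fin mulr_ge0 ?sqr_ge0.
  by apply: le_esum => g _; rewrite -EFinD lee_fin; exact: normc_sqr_lin.
by apply: lte_add_pinfty; rewrite lte_mul_pinfty ?lee_fin// ltW.
Qed.

HB.instance Definition _ :=
  GRing.isSubmodClosed.Build R[i] (gT -> R[i]) sq_summable sq_summable_submod.

Definition l2 := {xi : gT -> R[i] | xi \in sq_summable}.

HB.instance Definition _ := SubChoice.on l2.
HB.instance Definition _ := [SubChoice_isSubLmodule of l2 by <:].

Definition l2norm (xi : l2) : R := Num.sqrt (fine (sqnorm_sum (val xi))).

Lemma translate_sq_summable (g : gT) (xi : l2) :
  (fun h => val xi (g^-1 * h)%g) \in sq_summable.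
Proof.
have /sq_summableP xs := valP xi; apply/sq_summableP.
rewrite /sqnorm_sum.
rewrite -(@reindex_esum R gT gT setT setT (fun h => (g^-1 * h)%g)
  (fun h => (Normc.normc (val xi h) ^+ 2)%:E))//.
split=> //; first by move=> x y _ _ /mulgI.
by move=> x _; exists (g * x)%g => //; rewrite mulKg.
Qed.

Definition left_regular (g : gT) : l2 -> l2 :=
  fun xi => exist _ (fun h => val xi (g^-1 * h)%g) (translate_sq_summable g xi).

(* For [0 <= c], the operator norm of [T] is at most [c]. *)
Definition opnorm_le (T : l2 -> l2) (c : R) : Prop :=
  forall xi, l2norm (T xi) <= c * l2norm xi.

Definition bounded_operator (T : l2 -> l2) : Prop :=
  linear T /\ exists c, opnorm_le T c.

Definition group_algebra : set (l2 -> l2) :=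
  [set T | exists (s : seq gT) (a : gT -> R[i]),
    T = \sum_(g <- s) a g *: left_regular g].

Definition opnorm_closure (A : set (l2 -> l2)) : set (l2 -> l2) :=
  [set T | bounded_operator T /\
    forall e, 0 < e -> exists2 S, A S & opnorm_le (T - S) e].

Definition reduced_Cstar : set (l2 -> l2) := opnorm_closure group_algebra.

(* As [reduced_Cstar] contains the scalar operators, stability under
   multiplication by its elements includes stability under scaling. *)
Definition closed_ideal (A J : set (l2 -> l2)) : Prop :=
  [/\ J `<=` A,
      J 0,
      forall S T, J S -> J T -> J (S + T),
      forall S T, A S -> J T -> J (S \o T) /\ J (T \o S)
    & opnorm_closure J `<=` J].

Definition Cstar_simple : Prop :=
  forall J, closed_ideal reduced_Cstar J -> J = [set 0] \/ J = reduced_Cstar.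

End L2.

(* Main.v *)
Require Import Defs.
From HB Require Import structures.
From mathcomp Require Import all_boot all_order all_algebra.
From mathcomp Require Import finmap complex.
From mathcomp Require Import all_classical all_reals all_analysis.
From mathcomp Require Import ring lra.

Set Implicit Arguments.
Unset Strict Implicit.
Unset Printing Implicit Defensive.

Import Order.TTheory GRing.Theory Num.Theory numFieldNormedType.Exports.
Local Open Scope classical_set_scope.
Local Open Scope ring_scope.

(** Write [H_v] for the rigid stabilizer of a vertex [v] and [lambda] for the
    left regular representation. A subgroup [H] has a spectral gap when some
    finite average of the operators [lambda h], [h] in [H], has norm less than 1
    on [l^2(H)]; it is enough to test nonnegative, finitely supported functions
    ([contracts], [has_gap]). The theorem follows the dichotomy between the
    existence of a vertex below the root whose rigid stabilizer has no gap and
    the absence of such a vertex.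

    Without a gap for [H_v], there are almost invariant unit vectors, whose
    squares are almost invariant densities; an ultralimit of these is an
    invariant mean on [H_v] ([no_gap_mean]). By transitivity all the vertices of
    the level [n] of [v] have such a mean. Their rigid stabilizers commute, so
    the convolution of the means is invariant under all of them, hence under
    [RiSt n] ([mean_commuting_product]). This subgroup has finite index in
    [St n], which has finite index in [G]; the translates of the mean are
    finitely many and their average is an invariant mean on [G]
    ([mean_finite_orbit]), so [G] is amenable.

    Suppose now that every [H_v] has a gap, and let [t] move [v]. Then
    [t H_v t^-1 = H_(t v)] commutes with [H_v] and meets it trivially, and
    [h t h^-1 = h (t h^-1 t^-1) t] for [h] in [H_v]. There is a map [p] from [G]
    to [H_v] such that [p (h k x) = h (p x)] for [h] in [H_v] and [k] in
    [H_(t v)], so [h (t h^-1 t^-1)] maps the fibre over [q] onto the fibre over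
    [h q]. Taking [l^2]-norms along the fibres, the norm of the average of the
    operators [lambda (h t h^-1)] on [l^2(G)] is at most that of the average of
    the operators [lambda h] on [l^2(H_v)] ([contracts_lift]): here it matters
    that the coefficients are nonnegative. A gap can be amplified by
    convolution, so these averages can be made arbitrarily small, uniformly in
    the elements [t] that move [v]. Given finitely many nontrivial elements of
    [G], each of them moves a vertex of any sufficiently deep level, and
    averaging successively over the rigid stabilizers of all the vertices of
    such a level makes all of them small at once ([level_gap_opnorm]).

    This is the averaging property of Powers, and it implies simplicity: a
    nonzero ideal of the reduced algebra contains an element of trace 1, and
    suitable averages of its conjugates converge to the identity
    ([powers_averaging_Cstar_simple]). *)

(** * Inequalities for finite sums *)

Section FiniteSums.
Variable R : realType.

Lemma cauchy_schwarz_sum (I : Type) (r : seq I) (a b : I -> R) :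
  (\sum_(i <- r) a i * b i) ^+ 2 <=
  (\sum_(i <- r) a i ^+ 2) * (\sum_(i <- r) b i ^+ 2).
Proof.
have : 0 <= \sum_(i <- r) \sum_(j <- r) (a i * b j - a j * b i) ^+ 2.
  by apply: sumr_ge0 => i _; apply: sumr_ge0 => j _; exact: sqr_ge0.
have -> : \sum_(i <- r) \sum_(j <- r) (a i * b j - a j * b i) ^+ 2 =
    (\sum_(i <- r) \sum_(j <- r) a i ^+ 2 * b j ^+ 2) +
    (\sum_(i <- r) \sum_(j <- r) b i ^+ 2 * a j ^+ 2) -
    2 * (\sum_(i <- r) \sum_(j <- r) (a i * b i) * (a j * b j)).
  rewrite mulr_sumr -big_split -sumrB; apply: eq_bigr => i _ /=.
  rewrite mulr_sumr -big_split -sumrB; apply: eq_bigr => j _ /=.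
  by ring.
by rewrite -!big_distrlr /=; set A := \sum_(i <- r) _; set B := \sum_(i <- r) _;
  set C := \sum_(i <- r) _; nra.
Qed.

Lemma cauchy_schwarz_sqrt (I : Type) (r : seq I) (a b : I -> R) :
  \sum_(i <- r) a i * b i <=
  Num.sqrt (\sum_(i <- r) a i ^+ 2) * Num.sqrt (\sum_(i <- r) b i ^+ 2).
Proof.
have ge0 (c : I -> R) : 0 <= \sum_(i <- r) c i ^+ 2.
  by apply: sumr_ge0 => i _; exact: sqr_ge0.
rewrite -sqrtrM//; apply: (le_trans (ler_norm _)).
by rewrite -sqrtr_sqr ler_wsqrtr// cauchy_schwarz_sum.
Qed.

(** Expanding the square reduces this to the Cauchy-Schwarz inequality for
    each pair of summands. *)
Lemma minkowski_sum (I J : Type) (r : seq I) (s : seq J) (a : J -> I -> R) :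
  \sum_(i <- r) (\sum_(j <- s) a j i) ^+ 2 <=
  (\sum_(j <- s) Num.sqrt (\sum_(i <- r) a j i ^+ 2)) ^+ 2.
Proof.
rewrite [leRHS]expr2 big_distrlr /=.
under eq_bigr do rewrite expr2 big_distrlr /=.
rewrite exchange_big; apply: ler_sum => j _ /=.
rewrite exchange_big; apply: ler_sum => k _ /=.
exact: cauchy_schwarz_sqrt.
Qed.

Lemma ler_sum_fset (T : choiceType) (A B : {fset T}) (F : T -> R) :
  (forall x, x \in A -> x \notin B -> F x = 0) -> (forall x, 0 <= F x) ->
  \sum_(x <- A) F x <= \sum_(x <- B) F x.
Proof.
move=> F0 Fge0; rewrite (big_fsetID _ (mem B))/= [X in _ + X]big1_seq.
  rewrite addr0 (_ : [fset x in A | x \in B]%fset = (A `&` B)%fset); last first.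
    by apply/fsetP => x; rewrite !inE.
  rewrite [leRHS](big_fsetID _ (mem A))/=.
  rewrite (_ : [fset x in B | x \in A]%fset = (A `&` B)%fset); last first.
    by apply/fsetP => x; rewrite !inE andbC.
  by rewrite lerDl; apply: sumr_ge0.
by move=> x; rewrite /= !inE/= => /andP[xA xB]; exact: F0.
Qed.

(** Change of variable along an injection, when [B] contains the image of the
    part of [A] that contributes to the sum. *)
Lemma sum_fset_inj_le (T U : choiceType) (p : T -> U) (A : {fset T})
    (B : {fset U}) (F : U -> R) :
  injective p -> (forall x, x \in A -> F (p x) != 0 -> p x \in B) ->
  (forall x, 0 <= F x) ->
  \sum_(x <- A) F (p x) <= \sum_(y <- B) F y.
Proof.
move=> pinj AB F0.
have -> : \sum_(x <- A) F (p x) = \sum_(y <- [fset p x | x in A]%fset) F y.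
  by rewrite big_imfset//= => x y _ _ /pinj.
apply: ler_sum_fset => // y /imfsetP[x /= xA ->] pxB.
by apply/eqP; apply: contraNT pxB; exact: AB.
Qed.

End FiniteSums.

(** * The norm of square-summable functions *)

Section L2norm.
Variables (R : realType) (gT : groupType).
Implicit Types (xi eta : l2 R gT) (g h : gT).

Lemma normc_ge0 (z : R[i]) : 0 <= Normc.normc z.
Proof. by case: z => a b; exact: sqrtr_ge0. Qed.

Lemma l2norm_ge0 xi : 0 <= l2norm xi. Proof. exact: sqrtr_ge0. Qed.

Lemma sqnorm_sumE xi : sqnorm_sum (val xi) = (l2norm xi ^+ 2)%:E.
Proof.
have xoo : (sqnorm_sum (val xi) < +oo)%E by exact/sq_summableP/(valP xi).
have x0 : (0 <= sqnorm_sum (val xi))%E.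
  by apply: esum_ge0 => g _; rewrite lee_fin sqr_ge0.
rewrite /l2norm sqr_sqrtr ?fine_ge0// fineK//.
by rewrite ge0_fin_numE.
Qed.

Lemma sum_le_l2norm xi (B : {fset gT}) :
  \sum_(x <- B) Normc.normc (val xi x) ^+ 2 <= l2norm xi ^+ 2.
Proof.
rewrite -lee_fin -sqnorm_sumE; apply: esum_ge.
exists [set` B]; first by split => //; exact: finite_fset.
by rewrite fsbig_finite//= set_fsetK -sumEFin.
Qed.

Lemma l2norm_le xi (c : R) : 0 <= c ->
  (forall B : {fset gT},
    \sum_(x <- B) Normc.normc (val xi x) ^+ 2 <= c ^+ 2) -> l2norm xi <= c.
Proof.
move=> c0 H; rewrite -(@ler_pXn2r _ 2)// ?nnegrE ?l2norm_ge0//.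
rewrite -lee_fin -sqnorm_sumE; apply: ge_ereal_sup => _ [A [finA _] <-].
rewrite fsbig_finite// sumEFin lee_fin; exact: H.
Qed.

Lemma normc_le_l2norm xi g : Normc.normc (val xi g) <= l2norm xi.
Proof.
rewrite -(@ler_pXn2r _ 2)// ?nnegrE ?l2norm_ge0 ?normc_ge0//.
by have := sum_le_l2norm xi [fset g]%fset; rewrite big_seq_fset1.
Qed.

Lemma l2normD xi eta : l2norm (xi + eta) <= l2norm xi + l2norm eta.
Proof.
apply: l2norm_le => [|B]; first by rewrite addr_ge0 ?l2norm_ge0.
pose a (b : bool) x := Normc.normc (val (if b then xi else eta) x).
have aE F : \sum_(b <- [:: true; false]) F b = F true + F false :> R.
  by rewrite big_cons big_seq1.
apply: (@le_trans _ _ (\sum_(x <- B) (\sum_(b <- [:: true; false]) a b x) ^+ 2)).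
  apply: ler_sum => x _; rewrite aE lerXn2r ?nnegrE ?normc_ge0//.
    by rewrite addr_ge0 ?normc_ge0.
  exact: le_normcD.
apply: (le_trans (minkowski_sum _ _ _)).
rewrite aE lerXn2r ?nnegrE ?addr_ge0 ?sqrtr_ge0 ?l2norm_ge0//.
by apply: lerD; rewrite -[leRHS]ger0_norm ?l2norm_ge0// -sqrtr_sqr;
  rewrite ler_wsqrtr// sum_le_l2norm.
Qed.

Lemma l2normZ_le (a : R[i]) xi : l2norm (a *: xi) <= Normc.normc a * l2norm xi.
Proof.
apply: l2norm_le => [|B]; first by rewrite mulr_ge0 ?normc_ge0 ?l2norm_ge0.
rewrite exprMn (le_trans _ (ler_wpM2l (sqr_ge0 _) (sum_le_l2norm xi B)))//.
rewrite mulr_sumr; apply: ler_sum => x _.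
by rewrite -exprMn -Normc.normcM.
Qed.

Lemma l2norm_left_regular_le g xi : l2norm (left_regular g xi) <= l2norm xi.
Proof.
apply: l2norm_le => [|B]; first exact: l2norm_ge0.
apply: le_trans (sum_le_l2norm xi [fset (g^-1 * x)%g | x in B]%fset).
by rewrite big_imfset//= => x y _ _ /mulgI.
Qed.

End L2norm.

(** * Operator norms *)

Section Operators.
Variables (R : realType) (gT : groupType).
Implicit Types (xi eta : l2 R gT) (S T : l2 R gT -> l2 R gT) (g h : gT).
Implicit Types (c d : R).

Lemma left_regularM g h xi :
  left_regular (g * h) xi = left_regular g (left_regular h xi).
Proof. by apply: val_inj; apply/funext => x; rewrite /= invgM mulgA. Qed.

Lemma left_regular1 xi : left_regular 1%g xi = xi.
Proof. by apply: val_inj; apply/funext => x; rewrite /= invg1 mul1g. Qed.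

Lemma left_regular_linear g : linear (@left_regular R gT g).
Proof. by move=> a xi eta; apply: val_inj; apply/funext. Qed.

HB.instance Definition _ g := GRing.isLinear.Build R[i] (l2 R gT) (l2 R gT) _
  (left_regular g) (left_regular_linear g).

Lemma sum_opE (I : Type) (s : seq I) (P : pred I)
    (F : I -> l2 R gT -> l2 R gT) xi :
  (\sum_(i <- s | P i) F i) xi = \sum_(i <- s | P i) F i xi.
Proof. by elim/big_ind2: _ => // S a T b <- <-. Qed.

Lemma val_l2_sum (I : Type) (s : seq I) (F : I -> l2 R gT) x :
  val (\sum_(i <- s) F i) x = \sum_(i <- s) val (F i) x.
Proof. by elim/big_ind2: _ => // a u b v <- <-. Qed.

Lemma group_algebraE (s : seq gT) (a : gT -> R[i]) xi x :
  val ((\sum_(g <- s) a g *: left_regular g) xi) x =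
  \sum_(g <- s) a g * val xi (g^-1 * x)%g.
Proof. by rewrite sum_opE val_l2_sum. Qed.

Lemma opnorm_leW S c d : c <= d -> opnorm_le S c -> opnorm_le S d.
Proof.
by move=> cd Sc xi; apply: (le_trans (Sc xi)); rewrite ler_wpM2r ?l2norm_ge0.
Qed.

Lemma opnorm_leD S T c d :
  opnorm_le S c -> opnorm_le T d -> opnorm_le (S + T) (c + d).
Proof.
move=> Sc Td xi; apply: (le_trans (l2normD _ _)).
by rewrite mulrDl lerD.
Qed.

Lemma opnorm_leZ (a : R[i]) S c :
  opnorm_le S c -> opnorm_le (a *: S) (Normc.normc a * c).
Proof.
move=> Sc xi; apply: (le_trans (l2normZ_le _ _)).
by rewrite -mulrA ler_wpM2l ?normc_ge0.
Qed.

Lemma opnorm_leN S c : opnorm_le S c -> opnorm_le (- S) c.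
Proof.
move=> Sc; rewrite -scaleN1r -[c]mul1r.
have <- : Normc.normc (-1 : R[i]) = 1 by rewrite normcN Normc.normc1.
exact: opnorm_leZ.
Qed.

Lemma opnorm_le0 c : 0 <= c -> opnorm_le (0 : l2 R gT -> l2 R gT) c.
Proof.
move=> c0 xi; rewrite /l2norm [sqnorm_sum _]esum1 ?sqrtr0 => [|g _].
  by rewrite mulr_ge0 ?sqrtr_ge0.
by rewrite [Normc.normc _](@Normc.normc0 R) expr0n.
Qed.

Lemma opnorm_le_sum (I : Type) (s : seq I) (P : pred I)
    (F : I -> l2 R gT -> l2 R gT) (c : I -> R) :
  (forall i, P i -> opnorm_le (F i) (c i)) ->
  opnorm_le (\sum_(i <- s | P i) F i) (\sum_(i <- s | P i) c i).
Proof.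
move=> H; elim/big_ind2: _ => // [|S c' T d Sc Td]; first exact: opnorm_le0.
exact: opnorm_leD.
Qed.

Lemma opnorm_le_comp S T c d :
  0 <= c -> opnorm_le S c -> opnorm_le T d -> opnorm_le (S \o T) (c * d).
Proof.
move=> c0 Sc Td xi; apply: (le_trans (Sc _)).
by rewrite -mulrA ler_wpM2l.
Qed.

Lemma opnorm_le_left_regular g : opnorm_le (@left_regular R gT g) 1.
Proof. by move=> xi; rewrite mul1r l2norm_left_regular_le. Qed.

Lemma opnorm_le_conj g S c : 0 <= c ->
  opnorm_le S c -> opnorm_le (left_regular g \o S \o left_regular g^-1) c.
Proof.
move=> c0 Sc; rewrite -[c]mulr1; apply: opnorm_le_comp => //.
  by rewrite -[c]mul1r; apply: opnorm_le_comp => //; exact: opnorm_le_left_regular.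
exact: opnorm_le_left_regular.
Qed.

End Operators.

(** * Simplicity from Powers averaging *)

Section CstarSimplicity.
Variables (R : realType) (gT : groupType).
Implicit Types (xi eta : l2 R gT) (S T : l2 R gT -> l2 R gT) (g h : gT).

Let A := @reduced_Cstar R gT.

Lemma sum_delta1_le (B : {fset gT}) :
  \sum_(x <- B) Normc.normc ((x == 1%g)%:R : R[i]) ^+ 2 <= 1.
Proof.
apply: (@le_trans _ _ (\sum_(x <- [fset 1%g]%fset)
    Normc.normc ((x == 1%g)%:R : R[i]) ^+ 2)).
  apply: ler_sum_fset => x; last by rewrite sqr_ge0.
  by rewrite inE => _ /negPf ->; rewrite Normc.normc0 expr0n.
by rewrite big_seq_fset1 eqxx Normc.normc1 expr1n.
Qed.

Lemma delta1_sq_summable :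
  (fun g : gT => (g == 1%g)%:R : R[i]) \in @sq_summable R gT.
Proof.
apply/sq_summableP; rewrite (@le_lt_trans _ _ 1%:E) ?ltry//.
apply: ge_ereal_sup => _ [B [finB _] <-].
by rewrite fsbig_finite// sumEFin lee_fin sum_delta1_le.
Qed.

Definition delta1 : l2 R gT :=
  exist (fun f : gT -> R[i] => f \in @sq_summable R gT) _ delta1_sq_summable.

Lemma l2norm_delta1_le : l2norm delta1 <= 1.
Proof. by apply: l2norm_le => // B; rewrite expr1n; exact: sum_delta1_le. Qed.

Lemma group_algebra_delta1 (s : seq gT) (a : gT -> R[i]) g :
  val ((\sum_(g <- s) a g *: left_regular g) delta1) g =
  \sum_(h <- s | h == g) a h.
Proof.
rewrite group_algebraE [RHS]big_mkcond; apply: eq_bigr => h _ /=.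
have -> : (h^-1 * g == 1)%g = (h == g).
  apply/eqP/eqP => [hg|->]; last by rewrite mulVg.
  by rewrite -[LHS]mulg1 -hg mulVKg.
by case: eqP; rewrite ?mulr1 ?mulr0.
Qed.

Lemma normc_sum (I : Type) (s : seq I) (F : I -> R[i]) :
  Normc.normc (\sum_(i <- s) F i) <= \sum_(i <- s) Normc.normc (F i).
Proof.
elim/big_ind2: _ => // [|x a y b xa yb]; first by rewrite Normc.normc0.
by apply: le_trans (le_normcD _ _) _; exact: lerD.
Qed.

(** In coordinates [a xi] is the convolution of [a delta1] with [xi], so the
    Cauchy-Schwarz inequality applies. *)
Lemma group_algebra_pointwise (s : seq gT) (a : gT -> R[i]) xi x :
  Normc.normc (val ((\sum_(g <- s) a g *: left_regular g) xi) x) <=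
  l2norm ((\sum_(g <- s) a g *: left_regular g) delta1) * l2norm xi.
Proof.
set T := \sum_(g <- s) _; set B := [fset g in s]%fset.
have -> : val (T xi) x =
    \sum_(g <- B) val (T delta1) g * val xi (g^-1 * x)%g.
  rewrite group_algebraE.
  under [RHS]eq_bigr do rewrite group_algebra_delta1 mulr_suml big_mkcond.
  rewrite exchange_big /= big_seq [RHS]big_seq; apply: eq_bigr => g gs.
  rewrite (bigD1_seq g) ?fset_uniq ?inE//= eqxx big1 ?addr0// => h.
  by rewrite eq_sym => /negPf ->.
apply: (le_trans (normc_sum _ _)).
under eq_bigr do rewrite Normc.normcM.
apply: (le_trans (cauchy_schwarz_sqrt _ _ _)).
have le_l2 xi' (r : R) : r <= l2norm xi' ^+ 2 -> Num.sqrt r <= l2norm xi'.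
  move=> H; rewrite -[leRHS]ger0_norm ?l2norm_ge0// -sqrtr_sqr.
  exact: ler_wsqrtr.
apply: ler_pM; rewrite ?sqrtr_ge0//; apply: le_l2; first exact: sum_le_l2norm.
apply: le_trans (sum_le_l2norm xi [fset (g^-1 * x)%g | g in B]%fset).
by rewrite [leRHS]big_imfset//= => g h _ _ /mulIg /invg_inj.
Qed.

Lemma reduced_Cstar_approx T e : A T -> 0 < e ->
  exists s a, opnorm_le (T - \sum_(g <- s) a g *: left_regular g) e.
Proof.
by move=> [_ /(_ e)] + e0 => /(_ e0)[_ [s [a ->]] Ha]; exists s, a.
Qed.

(** The vector [delta1] is separating: by [group_algebra_pointwise], an element
    of the group algebra close to [T] has small coordinates everywhere if it
    almost kills [delta1]. *)
Lemma reduced_Cstar_eq0 T :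
  A T -> (forall g, val (T delta1) g = 0) -> T = 0.
Proof.
move=> AT T0; apply/funext => xi; apply: val_inj; apply/funext => x.
apply: Normc.eq0_normc; apply/eqP; rewrite eq_le normc_ge0 andbT.
apply/ler_addgt0Pr => e e0; rewrite add0r.
(* [l2norm xi + 1], unlike [l2norm xi], is positive. *)
pose d := e / (2 * (l2norm xi + 1)).
have xi1 : 0 < l2norm xi + 1 by rewrite ltr_wpDl ?l2norm_ge0.
have d0 : 0 < d by rewrite divr_gt0// mulr_gt0.
have [s [a]] := reduced_Cstar_approx AT d0; set a' := \sum_(g <- s) _ => Ha.
have -> : val (T xi) x = val ((T - a') xi) x + val (a' xi) x.
  by rewrite -[LHS](subrK (val (a' xi) x)).
apply: (le_trans (le_normcD _ _)).
have H1 := le_trans (normc_le_l2norm _ x) (Ha xi).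
have H2 : l2norm (a' delta1) <= d.
  have -> : a' delta1 = - (T - a') delta1.
    apply: val_inj; apply/funext => y.
    by rewrite -[LHS]subr0 -(T0 y) -opprB.
  rewrite -scaleN1r (le_trans (l2normZ_le _ _))//.
  rewrite normcN Normc.normc1 mul1r (le_trans (Ha _))//.
  by rewrite -[leRHS]mulr1 ler_wpM2l ?l2norm_delta1_le ?ltW.
have H3 := group_algebra_pointwise s a xi x.
have H4 : l2norm (a' delta1) * l2norm xi <= d * l2norm xi.
  by rewrite ler_wpM2r ?l2norm_ge0.
have -> : e = d * (l2norm xi + 1) + d * (l2norm xi + 1).
  by rewrite /d; field; rewrite gt_eqF.
by rewrite lerD//; rewrite mulrDr mulr1 ler_wpDr ?(ltW d0)//; apply: le_trans H4.
Qed.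

Lemma group_algebra_reduced (a : R[i]) g : A (a *: left_regular g).
Proof.
have Ab : opnorm_le (a *: @left_regular R gT g) (Normc.normc a * 1).
  by apply: opnorm_leZ; exact: opnorm_le_left_regular.
split; last first.
  move=> e e0; exists (a *: left_regular g).
    by exists [:: g], (fun=> a); rewrite big_seq1.
  by rewrite subrr; apply: opnorm_le0; exact: ltW.
split; last by exists (Normc.normc a * 1).
move=> b xi eta; rewrite /= !fctE linearP scalerDr !scalerA [a * b]mulrC.
by [].
Qed.

(** The conjugators [s] depend on [e] and on the finite set [F], but serve all
    the elements of [F] simultaneously. *)
Definition powers_averaging : Prop :=
  forall (F : seq gT) (e : R), 1%g \notin F -> 0 < e ->
  exists2 s : seq gT, s != [::] & forall t, t \in F ->
    opnorm_le (\sum_(h <- s) @left_regular R gT (h * t * h^-1)%g)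
      (e * (size s)%:R).

Section Ideal.
Variable J : set (l2 R gT -> l2 R gT).
Hypothesis idealJ : closed_ideal A J.

Lemma ideal_compl T (a : R[i]) g : J T -> J (a *: (left_regular g \o T)).
Proof.
case: idealJ => _ _ _ JM _ JT.
exact: (JM _ _ (group_algebra_reduced a g) JT).1.
Qed.

Lemma ideal_conj T g : J T -> J (left_regular g \o T \o left_regular g^-1).
Proof.
case: idealJ => _ _ _ JM _ JT.
have := (JM _ _ (group_algebra_reduced 1 g^-1) (ideal_compl 1 g JT)).2.
by rewrite !scale1r.
Qed.

Lemma ideal_sum (I : Type) (s : seq I) (F : I -> l2 R gT -> l2 R gT) :
  (forall i, J (F i)) -> J (\sum_(i <- s) F i).
Proof.
case: idealJ => _ J0 JD _ _ JF.
by elim/big_ind: _ => // S T; exact: JD.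
Qed.

(** [T] is [alpha id] plus a combination of nontrivial translations, up to an
    operator of norm at most [d]; averaging the conjugates of [T] over [s]
    makes the translations small and leaves the two other terms alone. *)
Lemma conj_average_close (T : l2 R gT -> l2 R gT) (s S : seq gT)
    (a : gT -> R[i]) (d e : R) : 0 <= d ->
  opnorm_le (T - \sum_(g <- S) a g *: left_regular g) d ->
  (forall t, t \in S -> t != 1%g ->
    opnorm_le (\sum_(h <- s) @left_regular R gT (h * t * h^-1)%g) e) ->
  opnorm_le (\sum_(h <- s) (left_regular h \o T \o left_regular h^-1) -
      ((\sum_(g <- S | g == 1%g) a g) *+ size s) *: idfun)
    (d * (size s)%:R + \sum_(g <- S | g != 1%g) Normc.normc (a g) * e).
Proof.
move=> d0 Td small; set D := T - _ in Td; set alpha := \sum_(g <- S | _) a g.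
have -> : \sum_(h <- s) (left_regular h \o T \o left_regular h^-1) -
      (alpha *+ size s) *: idfun =
    \sum_(h <- s) (left_regular h \o D \o left_regular h^-1) +
    \sum_(g <- S | g != 1%g)
      a g *: \sum_(h <- s) @left_regular R gT (h * g * h^-1)%g.
  apply/funext => xi.
  rewrite -[LHS]/(_ xi - (alpha *+ size s) *: xi) -[RHS]/(_ xi + _ xi) !sum_opE.
  have conjE h : left_regular h (T (left_regular h^-1 xi)) =
      left_regular h (D (left_regular h^-1 xi)) +
      \sum_(g <- S) a g *: left_regular (h * g * h^-1)%g xi.
    have -> : T (left_regular h^-1 xi) = D (left_regular h^-1 xi) +
        \sum_(g <- S) a g *: left_regular g (left_regular h^-1 xi).
      by rewrite -(sum_opE _ _ (fun g => a g *: left_regular g)) [RHS]subrK.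
    rewrite linearD linear_sum; congr (_ + _); apply: eq_bigr => g _.
    by rewrite linearZ/= !left_regularM.
  under eq_bigr do rewrite /= conjE (bigID (fun g => g == 1%g))/=.
  rewrite !big_split/= -!addrA; congr (_ + _).
  have -> : \sum_(h <- s) \sum_(g <- S | g == 1%g)
      a g *: left_regular (h * g * h^-1)%g xi = (alpha *+ size s) *: xi.
    transitivity (\sum_(h <- s) alpha *: xi); last first.
      by rewrite big_const_seq count_predT iter_addr_0 scalerMnl.
    apply: eq_bigr => h _; rewrite scaler_suml; apply: eq_bigr => g /eqP ->.
    by rewrite mulg1 mulgV left_regular1.
  rewrite addrC subrK exchange_big /=. apply: eq_bigr => g _.
  by rewrite -scaler_sumr -[RHS]/(_ *: _ xi) sum_opE.
apply: opnorm_leD.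
  rewrite [d * _](_ : _ = \sum_(h <- s) d).
    by apply: opnorm_le_sum => h _; exact: opnorm_le_conj.
  by rewrite big_const_seq count_predT iter_addr_0 mulr_natr.
rewrite big_seq_cond [X in opnorm_le _ X]big_seq_cond.
apply: opnorm_le_sum => g /andP[gS g1]; apply: opnorm_leZ; exact: small.
Qed.


(** The trace of [T] is the coordinate at 1 of [T delta1]; some translate of a
    nonzero [T] has nonzero trace. *)
Lemma ideal_nonzero_trace1 T : J T -> T <> 0 ->
  exists2 T', J T' & val (T' delta1) 1%g = 1.
Proof.
move=> JT T0; have [JA _ _ _ _] := idealJ.
have [g Tg] : exists g, val (T delta1) g != 0.
  apply: contrapT => /forallNP H; apply: T0; apply: reduced_Cstar_eq0 => [|g].
    exact: JA.
  by apply/eqP/negPn/negP; exact: (H g).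
exists ((val (T delta1) g)^-1 *: (left_regular g^-1 \o T)).
  exact: ideal_compl.
by rewrite /= invgK -[LHS]/(_ * sval _ (g * 1)%g) mulg1 mulVf.
Qed.

(** Averages of conjugates of an element of [J] of trace 1 lie in [J] and
    approach the identity, and [J] is closed. *)
Lemma powers_averaging_ideal T :
  powers_averaging -> J T -> T <> 0 -> J idfun.
Proof.
move=> powers JT0 T0; have [T' JT T1] := ideal_nonzero_trace1 JT0 T0.
have [JA _ _ _ Jcl] := idealJ.
apply: Jcl; split.
  by split; [|exists 1 => xi; rewrite mul1r].
(* One third of [e] for each of the following: the distance from [T'] to the
   group algebra, the error on the trace, the averaged translations. *)
move=> e e0; have e3 : 0 < e / 3 by rewrite divr_gt0.
have [S [a Ha]] := reduced_Cstar_approx (JA _ JT) e3.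
set M := \sum_(g <- S | g != 1%g) Normc.normc (a g).
have M0 : 0 <= M by apply: sumr_ge0 => g _; exact: normc_ge0.
have eM : 0 < e / 3 / (M + 1) by rewrite divr_gt0// ltr_wpDl.
have [|s s0 Hs] := powers [seq g <- S | g != 1%g] _ _ eM.
  by rewrite mem_filter eqxx.
have n0 : 0 < (size s)%:R :> R by rewrite ltr0n lt0n size_eq0.
set n := (size s)%:R in n0 Hs *.
have small t : t \in S -> t != 1%g ->
    opnorm_le (\sum_(h <- s) @left_regular R gT (h * t * h^-1)%g)
      (e / 3 / (M + 1) * n).
  by move=> tS t1; apply: Hs; rewrite mem_filter t1.
have := conj_average_close (ltW e3) Ha small.
set alpha := \sum_(g <- S | _) a g; set P := \sum_(h <- s) _.
rewrite -mulr_suml -/M => HP.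
have alpha1 : Normc.normc (1 - alpha) <= e / 3.
  have := le_trans (normc_le_l2norm _ 1%g) (Ha delta1).
  have -> : val ((T' - \sum_(g <- S) a g *: left_regular g) delta1) 1%g =
      1 - alpha.
    by rewrite -T1 /alpha -group_algebra_delta1.
  move=> /le_trans; apply.
  by rewrite -[leRHS]mulr1 ler_wpM2l ?l2norm_delta1_le ?ltW.
pose c : R[i] := (n^-1)%:C%C.
have cn : c * (size s)%:R = 1.
  rewrite /c -[X in _ * X](rmorph_nat (real_complex R)) -rmorphM mulVf ?rmorph1//.
  by rewrite gt_eqF.
exists (c *: P).
  have := ideal_compl c 1%g (ideal_sum s (fun h => ideal_conj h JT)).
  congr J; congr (_ *: _); apply/funext => xi /=; exact: left_regular1.
have -> : idfun - c *: P = (1 - alpha) *: idfun +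
    - (c *: (P - (alpha *+ size s) *: idfun)).
  rewrite scalerBr scalerA -mulr_natr mulrCA cn mulr1 scalerBl scale1r.
  by rewrite opprB addrA addrNK.
apply: (@opnorm_leW _ _ _ (Normc.normc (1 - alpha) * 1 + Normc.normc c *
  (e / 3 * n + M * (e / 3 / (M + 1) * n)))); last first.
  apply: opnorm_leD; first by apply: opnorm_leZ => xi; rewrite mul1r.
  by apply: opnorm_leN; exact: opnorm_leZ.
have -> : Normc.normc c = n^-1.
  by rewrite /c /= expr0n addr0 sqrtr_sqr ger0_norm// invr_ge0 ltW.
rewrite mulr1.
have -> : n^-1 * (e / 3 * n + M * (e / 3 / (M + 1) * n)) =
    e / 3 + e / 3 * (M / (M + 1)).
  by field; rewrite !gt_eqF// ltr_wpDl.
have : e / 3 * (M / (M + 1)) <= e / 3.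
  rewrite ler_piMr ?(ltW e3)// ler_pdivrMr ?mul1r ?lerDl// ltr_wpDl//.
by move: alpha1; lra.
Qed.

End Ideal.

Theorem powers_averaging_Cstar_simple : powers_averaging -> Cstar_simple R gT.
Proof.
move=> powers J idealJ.
have [[T JT T0]|J0] := pselect (exists2 T, J T & T <> 0); [right|left].
  have J1 := powers_averaging_ideal idealJ powers JT T0.
  have [JA _ _ JM _] := idealJ.
  by apply/seteqP; split => // S AS; have [] := JM _ _ AS J1.
have [_ JJ0 _ _ _] := idealJ.
apply/seteqP; split => [T JT|T ->//]; apply: contrapT => T0; apply: J0.
by exists T.
Qed.

End CstarSimplicity.

(** * Sums of translations bounded on a subgroup *)

Section Contraction.
Variables (R : realType) (gT : groupType).
Implicit Types (H : set gT) (s : seq gT) (c d : R) (g h t x y : gT).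
Implicit Types (f u : gT -> R) (A B : {fset gT}).

(** The sum of the translations by the elements of [s] has norm at most
    [c * size s] on [l^2(H)]. Nonnegative finitely supported functions suffice,
    since the translations have nonnegative coefficients. *)
Definition contracts H s c : Prop := forall f A B,
  (forall x, 0 <= f x) -> (forall x, x \notin A -> f x = 0) ->
  [set` A] `<=` H ->
  \sum_(x <- B) (\sum_(h <- s) f (h^-1 * x)%g) ^+ 2 <=
  (c * (size s)%:R) ^+ 2 * \sum_(x <- A) f x ^+ 2.

(** The bound transfers to the translations by [k h] along a fibration [p] that
    intertwines [k h] with [h]: Minkowski's inequality in each fibre of [p]
    reduces the sum for [u] to the sum for the function [f] whose value at [q]
    is the norm of [u] on the fibre over [q]. *)
Lemma contracts_lift H s c (k p : gT -> gT) u A B : contracts H s c ->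
  (forall x, H (p x)) ->
  (forall h x, h \in s -> p (k h * x)%g = (h * p x)%g) ->
  (forall x, 0 <= u x) -> (forall x, x \notin A -> u x = 0) ->
  \sum_(x <- B) (\sum_(h <- s) u ((k h)^-1 * x)%g) ^+ 2 <=
  (c * (size s)%:R) ^+ 2 * \sum_(x <- A) u x ^+ 2.
Proof.
move=> sc Hp pk u0 uA.
pose f q := Num.sqrt (\sum_(x <- A | p x == q) u x ^+ 2).
have f2 q : f q ^+ 2 = \sum_(x <- A | p x == q) u x ^+ 2.
  by rewrite sqr_sqrtr// sumr_ge0// => x _; exact: sqr_ge0.
have f0 q : q \notin [fset p x | x in A]%fset -> f q = 0.
  move=> qA; rewrite /f big1_seq ?sqrtr0// => x /andP[/eqP pxq xA].
  by move: qA; rewrite -pxq in_imfset.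
have HA : [set` [fset p x | x in A]%fset] `<=` H.
  by move=> _ /imfsetP[x _ ->]; exact: Hp.
have := sc f _ [fset p x | x in B]%fset (fun _ => sqrtr_ge0 _) f0 HA.
have -> : \sum_(q <- [fset p x | x in A]%fset) f q ^+ 2 =
    \sum_(x <- A) u x ^+ 2.
  by rewrite [RHS](partition_big_imfset _ p); apply: eq_bigr => q _; exact: f2.
apply: le_trans; rewrite [leLHS](partition_big_imfset _ p).
apply: ler_sum => q _; rewrite -big_filter.
apply: (le_trans (minkowski_sum _ _ _)).
rewrite lerXn2r ?nnegrE; [by []| | |].
- by apply: sumr_ge0 => h _; exact: sqrtr_ge0.
- by apply: sumr_ge0 => h _; exact: sqrtr_ge0.
rewrite big_seq [leRHS]big_seq; apply: ler_sum => h hs.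
rewrite ler_wsqrtr// big_filter big_mkcond [leRHS]big_mkcond/=.
pose F y := if p y == (h^-1 * q)%g then u y ^+ 2 else 0.
rewrite (eq_bigr (fun x => F ((k h)^-1 * x)%g)) => [|x _]; last first.
  have := pk h ((k h)^-1 * x)%g hs; rewrite mulVKg /F => ->.
  by rewrite -[_ == (h^-1 * q)%g](inj_eq (mulgI h)) mulVKg.
apply: sum_fset_inj_le => [|x _|y]; first exact: mulgI.
  rewrite /F; case: ifP; rewrite ?eqxx// => _.
  by apply: contraR => /uA ->; rewrite expr0n.
by rewrite /F; case: ifP => // _; exact: sqr_ge0.
Qed.

Lemma contracts_opnorm H s c (k p : gT -> gT) t : 0 <= c ->
  contracts H s c -> (forall x, H (p x)) ->
  (forall h x, h \in s -> p (k h * x)%g = (h * p x)%g) ->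
  opnorm_le (\sum_(h <- s) @left_regular R gT (k h * t)%g) (c * (size s)%:R).
Proof.
move=> c0 sc Hp pk xi; apply: l2norm_le => [|B].
  by rewrite mulr_ge0 ?l2norm_ge0// mulr_ge0.
(* [A] contains all the points at which the sum over [B] evaluates [u]. *)
pose A := [fset ((k h)^-1 * x)%g | h in s, x in B]%fset.
pose u y := if y \in A then Normc.normc (val xi (t^-1 * y)%g) else 0.
have u0 y : 0 <= u y by rewrite /u; case: ifP => // _; exact: normc_ge0.
have uA y : y \notin A -> u y = 0 by rewrite /u => /negPf ->.
rewrite exprMn; apply: (@le_trans _ _
    (\sum_(x <- B) (\sum_(h <- s) u ((k h)^-1 * x)%g) ^+ 2)).
  rewrite big_seq [leRHS]big_seq; apply: ler_sum => x xB.
  rewrite lerXn2r ?nnegrE ?normc_ge0 ?sumr_ge0//.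
  rewrite sum_opE val_l2_sum; apply: (le_trans (normc_sum _ _)).
  rewrite big_seq [leRHS]big_seq; apply: ler_sum => h hs.
  rewrite /u ifT; first by rewrite /= invgM mulgA.
  by apply/imfset2P; exists h => //; exists x.
apply: (le_trans (contracts_lift B sc Hp pk u0 uA)).
rewrite ler_wpM2l ?sqr_ge0//.
apply: le_trans (sum_le_l2norm xi [fset (t^-1 * y)%g | y in A]%fset).
rewrite [leRHS]big_imfset/= => [|x y _ _ /mulgI //].
by rewrite big_seq [leRHS]big_seq; apply: ler_sum => y yA; rewrite /u yA.
Qed.

End Contraction.

(** * Spectral gap *)

Section Gap.
Variables (R : realType) (gT : groupType).
Implicit Types (H : set gT) (s : seq gT) (c d : R) (g h t x y : gT).
Implicit Types (f u phi psi : gT -> R) (A B : {fset gT}).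

Lemma contracts_mul H s s' c d :
  (forall x y, H x -> H y -> H (x * y)%g) -> {subset s' <= H} ->
  contracts H s c -> contracts H s' d ->
  contracts H [seq (x * y)%g | x <- s, y <- s'] (c * d).
Proof.
move=> HM s'H sc sd f A B f0 fA AH.
pose f' y := \sum_(b <- s') f (b^-1 * y)%g.
pose A' := [fset (b * y)%g | b in s', y in A]%fset.
have f'0 y : 0 <= f' y by apply: sumr_ge0 => b _; exact: f0.
have f'A y : y \notin A' -> f' y = 0.
  move=> yA; rewrite /f' big1_seq// => b /= bs; apply: fA.
  apply: contra yA => yA; apply/imfset2P; exists b => //.
  by exists (b^-1 * y)%g => //; rewrite mulVKg.
have A'H : [set` A'] `<=` H.
  by move=> _ /imfset2P[b bs [y yA ->]]; apply: HM; [exact/set_mem/s'H|exact: AH].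
have E1 : \sum_(x <- B) (\sum_(h <- [seq (x * y)%g | x <- s, y <- s'])
    f (h^-1 * x)%g) ^+ 2 = \sum_(x <- B) (\sum_(h <- s) f' (h^-1 * x)%g) ^+ 2.
  apply: eq_bigr => x _; congr (_ ^+ 2); rewrite big_allpairs_dep.
  apply: eq_bigr => a _; apply: eq_bigr => b _.
  by rewrite invgM mulgA.
rewrite E1 (le_trans (sc f' A' B f'0 f'A A'H))//.
rewrite size_allpairs natrM mulrACA [leRHS](_ : _ = (c * (size s)%:R) ^+ 2 *
  ((d * (size s')%:R) ^+ 2 * \sum_(x <- A) f x ^+ 2)); last by ring.
rewrite ler_wpM2l ?sqr_ge0//; exact: sd.
Qed.

Definition has_gap H : Prop := exists s (c : R),
  [/\ s != [::], {subset s <= H}, 0 <= c < 1 & contracts H s c].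

(** Convolution powers of [s] have bounds that decrease geometrically. *)
Lemma has_gap_small H (e : R) : (forall x y, H x -> H y -> H (x * y)%g) ->
  has_gap H -> 0 < e ->
  exists s, [/\ s != [::], {subset s <= H} & contracts H s e].
Proof.
move=> HM [s [c [s0 sH /andP[c0 c1] sc]]] e0.
have [n cn] : exists n, c ^+ n.+1 <= e.
  have := @cvg_expr R c; rewrite ger0_norm// => /(_ c1).
  move=> /cvgr0Pnorm_le /(_ _ e0) [n _ /(_ n.+1 (leqnSn n))] /= cn.
  by exists n; rewrite (le_trans (ler_norm _)).
have [s' [s'0 s'H sc']] : exists s', [/\ s' != [::], {subset s' <= H} &
    contracts H s' (c ^+ n.+1)].
  elim: n {cn} => [|n [s' [s'0 s'H sc']]]; first by exists s; rewrite expr1.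
  exists [seq (x * y)%g | x <- s, y <- s']; split.
  - by rewrite -size_eq0 size_allpairs muln_eq0 !size_eq0 negb_or s0.
  - move=> _ /allpairsP[[x y] /= [xs ys ->]]; apply/mem_set/HM.
      exact/set_mem/sH.
    exact/set_mem/s'H.
  - by rewrite exprS; exact: contracts_mul.
exists s'; split=> // f A B f0 fA AH; apply: (le_trans (sc' _ _ B f0 fA AH)).
rewrite ler_wpM2r//; first by apply: sumr_ge0 => x _; exact: sqr_ge0.
rewrite lerXn2r ?nnegrE ?mulr_ge0 ?exprn_ge0 ?(ltW e0)//.
exact: ler_wpM2r.
Qed.

Lemma sum_sqr_sub (s : seq gT) (a : gT -> R) :
  \sum_(h <- s) \sum_(k <- s) (a h - a k) ^+ 2 =
  2 * ((size s)%:R * \sum_(h <- s) a h ^+ 2 - (\sum_(h <- s) a h) ^+ 2).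
Proof.
have sizeE (b : R) : \sum_(k <- s) b = (size s)%:R * b.
  by rewrite big_const_seq count_predT iter_addr_0 mulr_natl.
under eq_bigr => h _.
  under eq_bigr do rewrite sqrrB.
  rewrite big_split sumrB/= sizeE sumrMnl -mulr_sumr.
  over.
rewrite big_split sumrB/= -mulr_sumr sizeE sumrMnl -mulr_suml; ring.
Qed.

(** If the average of the translates of [f] over [1 :: F] has almost the same
    norm as [f] then, by [sum_sqr_sub], the translates are close to [f], and
    [f ^ 2], once normalised, is an almost invariant probability density. *)
Lemma no_gap_density H (F : seq gT) (e : R) : H 1%g -> ~ has_gap H ->
  {subset F <= H} -> 0 < e ->
  exists w A, [/\ forall x, 0 <= w x, [set` A] `<=` H, \sum_(x <- A) w x = 1 &
    forall h phi C, h \in F -> (forall x, `|phi x| <= C) ->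
      `|\sum_(x <- A) w x * phi (h * x)%g - \sum_(x <- A) w x * phi x|
        <= e * C].
Proof.
move=> H1 nogap FH e0; pose s := 1%g :: F; pose n : R := (size s)%:R.
have n0 : 0 < n by rewrite ltr0n.
(* The denominator makes [16 n^2 d <= e^2], which is what the last estimate
   needs, while keeping [d <= 1]. *)
pose d := e ^+ 2 / (16 * n ^+ 2 + e ^+ 2).
have den0 : 0 < 16 * n ^+ 2 + e ^+ 2 by rewrite addr_gt0 ?mulr_gt0 ?exprn_gt0.
have d0 : 0 < d by rewrite divr_gt0// exprn_gt0.
have d1 : d <= 1 by rewrite ler_pdivrMr// mul1r lerDr mulr_ge0 ?sqr_ge0.
have dn : 16 * n ^+ 2 * d <= e ^+ 2.
  rewrite /d mulrA ler_pdivrMr//; have := sqr_ge0 (e ^+ 2).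
  by rewrite mulrDr -expr2; lra.
have [f [A [B [f0 fA AH fB]]]] : exists f A B,
    [/\ forall x, 0 <= f x, forall x, x \notin A -> f x = 0, [set` A] `<=` H &
    ((1 - d) * n) ^+ 2 * \sum_(x <- A) f x ^+ 2 <
    \sum_(x <- B) (\sum_(h <- s) f (h^-1 * x)%g) ^+ 2].
  apply: contrapT => no; apply: nogap; exists s, (1 - d); split => //.
  - move=> x; rewrite inE => /orP[/eqP ->|/FH //]; exact/mem_set.
  - by apply/andP; split; lra.
  - move=> f A B f0 fA AH; rewrite leNgt; apply/negP => lt.
    by apply: no; exists f, A, B.
set N := \sum_(x <- A) f x ^+ 2 in fB.
(* [D] contains the supports of all the translates of [f], so that they have the
   same sum of squares over [D], and [B], so that [fB] is a lower bound. *)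
pose D := (B `|` [fset (h * x)%g | h in s, x in A])%fset.
pose fh h x := f (h^-1 * x)%g.
have sumD (h : gT) (psi : gT -> R) : h \in s ->
    \sum_(y <- D) fh h y ^+ 2 * psi y = \sum_(x <- A) f x ^+ 2 * psi (h * x)%g.
  move=> hs; transitivity (\sum_(y <- [fset (h * x)%g | x in A]%fset)
      fh h y ^+ 2 * psi y).
    symmetry; apply: big_fset_incl.
      apply/fsubsetP => _ /imfsetP[x /= xA ->]; rewrite inE; apply/orP; right.
      by apply/imfset2P; exists h => //; exists x.
    move=> y _ yA; rewrite /fh fA ?expr0n ?mul0r//.
    apply: contra yA => yA; apply/imfsetP; exists (h^-1 * y)%g => //.
    by rewrite mulVKg.
  rewrite big_imfset/= => [|x y _ _ /mulgI//].
  by apply: eq_bigr => x _; rewrite /fh mulKg.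
have sumD1 h : h \in s -> \sum_(y <- D) fh h y ^+ 2 = N.
  move=> hs; have := sumD h (fun=> 1) hs.
  by rewrite /N; under eq_bigr do rewrite mulr1; under [in RHS]eq_bigr do rewrite mulr1.
have N0 : 0 <= N by apply: sumr_ge0 => x _; exact: sqr_ge0.
have defect : \sum_(x <- D) \sum_(h <- s) \sum_(k <- s) (fh h x - fh k x) ^+ 2 =
    2 * (n ^+ 2 * N - \sum_(x <- D) (\sum_(h <- s) fh h x) ^+ 2).
  under eq_bigr do rewrite (sum_sqr_sub s (fh ^~ _)).
  rewrite -mulr_sumr sumrB -mulr_sumr exchange_big/= big_seq.
  under eq_bigr => h hs do rewrite sumD1//.
  rewrite -big_seq big_const_seq count_predT iter_addr_0.
  by rewrite -[N *+ _]mulr_natl expr2 -[n * n * N]mulrA.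
have fBD : \sum_(x <- B) (\sum_(h <- s) f (h^-1 * x)%g) ^+ 2 <=
    \sum_(x <- D) (\sum_(h <- s) fh h x) ^+ 2.
  apply: ler_sum_fset => x; last exact: sqr_ge0.
  by rewrite inE => ->.
have defect_ge0 : 0 <= \sum_(x <- D) \sum_(h <- s) \sum_(k <- s)
    (fh h x - fh k x) ^+ 2.
  by do 3![apply: sumr_ge0 => ? _]; exact: sqr_ge0.
have Npos : 0 < N.
  rewrite lt_neqAle N0 andbT eq_sym; apply/eqP => N00.
  by move: defect_ge0 fB fBD; rewrite defect N00 !mulr0; lra.
have close h : h \in s ->
    \sum_(x <- D) (fh h x - fh 1%g x) ^+ 2 <= 4 * n ^+ 2 * d * N.
  move=> hs; apply: (@le_trans _ _ (\sum_(x <- D) \sum_(h <- s) \sum_(k <- s)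
      (fh h x - fh k x) ^+ 2)).
    apply: ler_sum => x _; rewrite (big_rem h)//= -[leLHS]addr0 lerD//.
      rewrite (big_rem 1%g) ?mem_head//= lerDl.
      by apply: sumr_ge0 => ? _; exact: sqr_ge0.
    by do 2![apply: sumr_ge0 => ? _]; exact: sqr_ge0.
  rewrite defect; have : 0 <= n ^+ 2 * d ^+ 2 * N by rewrite mulr_ge0// mulr_ge0 ?sqr_ge0.
  by move: (lt_le_trans fB fBD); rewrite exprMn sqrrB expr1n; lra.
exists (fun x => f x ^+ 2 / N), A; split => //.
- by move=> x; rewrite divr_ge0 ?sqr_ge0.
- by rewrite -mulr_suml divff// gt_eqF.
move=> h phi C hF phiC; have hs : h \in s by rewrite inE hF orbT.
have C0 : 0 <= C by apply: le_trans (phiC 1%g).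
(* From vectors to densities: a difference of squares factors, and the
   Cauchy-Schwarz inequality bounds its [l^1]-norm. *)
have -> : \sum_(x <- A) f x ^+ 2 / N * phi (h * x)%g -
    \sum_(x <- A) f x ^+ 2 / N * phi x =
    N^-1 * \sum_(x <- D) ((fh h x - fh 1%g x) * (fh h x + fh 1%g x)) * phi x.
  under [X in _ = _ * X]eq_bigr do rewrite -subr_sqr mulrBl.
  rewrite sumrB !sumD ?mem_head// mulrBr !mulr_sumr.
  congr (_ - _); apply: eq_bigr => x _; last rewrite mul1g.
    by rewrite mulrAC mulrC.
  by rewrite mulrAC mulrC.
rewrite normrM ger0_norm ?invr_ge0// mulrC ler_pdivrMr//.
apply: (le_trans (ler_norm_sum _ _ _)).
apply: (@le_trans _ _ (\sum_(x <- D)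
    `|fh h x - fh 1%g x| * `|fh h x + fh 1%g x| * C)).
  by apply: ler_sum => x _; rewrite !normrM ler_wpM2l ?mulr_ge0.
rewrite -mulr_suml mulrAC ler_wpM2r//.
apply: (le_trans (cauchy_schwarz_sqrt _ _ _)).
rewrite -sqrtrM; last by apply: sumr_ge0 => x _; exact: sqr_ge0.
rewrite -[leRHS]ger0_norm ?mulr_ge0 ?(ltW e0)// -sqrtr_sqr ler_wsqrtr//.
under eq_bigr do rewrite -normrX ger0_norm ?sqr_ge0//.
under [X in _ * X]eq_bigr do rewrite -normrX ger0_norm ?sqr_ge0//.
have sum4 : \sum_(x <- D) (fh h x + fh 1%g x) ^+ 2 <= 4 * N.
  have -> : 4 * N = \sum_(x <- D) (2 * fh h x ^+ 2 + 2 * fh 1%g x ^+ 2).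
    by rewrite big_split/= -!mulr_sumr !sumD1 ?mem_head//; ring.
  apply: ler_sum => x _; have := sqr_ge0 (fh h x - fh 1%g x).
  by rewrite sqrrB sqrrD; lra.
have dN : 16 * n ^+ 2 * d * N ^+ 2 <= e ^+ 2 * N ^+ 2.
  by rewrite ler_wpM2r ?sqr_ge0.
apply: (@le_trans _ _ (4 * n ^+ 2 * d * N * (4 * N))).
  by apply: ler_pM => //; [apply: sumr_ge0 => x _; exact: sqr_ge0..|exact: close].
by rewrite exprMn (le_trans _ dN)//; lra.
Qed.

End Gap.

(** * Ultralimits *)

Section Ultralimit.
Variables (R : realType) (T : Type) (U : set_system T).
Context {ultraU : UltraFilter U}.

(** Compactness of the segment from [- C] to [C] gives a cluster point, and a
    cluster point of an ultrafilter is a limit. *)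
Lemma ultra_bounded_cvg (u : T -> R) (C : R) :
  U [set t | `|u t| <= C] -> exists l : R, u @ U --> l.
Proof.
move=> UC.
have : compact `[- C, C]%classic := @segment_compact R (- C) C.
move=> /(_ (u @ U) _) [|l [_ clu]].
  by apply: (@filterS T U _ _ _ _ UC) => t /=; rewrite in_itv/= -ler_norml.
exists l => V Vl; have [//|UV] := in_ultra_setVsetC (u @^-1` V) ultraU.
by have [] := clu (~` V) V UV Vl => z [].
Qed.

Definition ulim (u : T -> R) : R := xget 0 [set l : R | u @ U --> l].

Lemma ulimE (u : T -> R) l : u @ U --> l -> ulim u = l.
Proof.
move=> ul; apply: xget_unique => // l' ul'.
by apply: (@cvg_unique _ (@Rhausdorff R) _ _ _ _ ul' ul).
Qed.

Lemma ulim_cvg (u : T -> R) (C : R) :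
  U [set t | `|u t| <= C] -> u @ U --> ulim u.
Proof.
by move=> /ultra_bounded_cvg[l ul]; rewrite (ulimE ul).
Qed.

End Ultralimit.

(** * Invariant means *)

Section Means.
Variables (R : realType) (gT : groupType).
Implicit Types (H : set gT) (g h x y : gT) (phi psi : gT -> R).
Implicit Types (m : (gT -> R) -> R).

Definition bounded_fct phi := exists C : R, forall x, `|phi x| <= C.

(** Only the values at bounded functions matter, so that an ultralimit of means
    is a mean whatever its values at the other functions. *)
Record is_mean m : Prop := IsMean {
  mean_add : forall phi psi, bounded_fct phi -> bounded_fct psi ->
    m (fun x => phi x + psi x) = m phi + m psi;
  mean_scale : forall (a : R) phi, bounded_fct phi ->
    m (fun x => a * phi x) = a * m phi;
  mean_one : m (fun=> 1) = 1;
  mean_ge0 : forall phi, bounded_fct phi -> (forall x, 0 <= phi x) -> 0 <= m phi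
}.

Definition mean_invariant m g :=
  forall phi, bounded_fct phi -> m (fun x => phi (g * x)%g) = m phi.

Definition mean_concentrated_on H m :=
  forall phi psi, bounded_fct phi -> bounded_fct psi ->
  (forall x, H x -> phi x = psi x) -> m phi = m psi.

Lemma bounded_cst (a : R) : bounded_fct (fun=> a).
Proof. by exists `|a|. Qed.

Lemma bounded_add phi psi : bounded_fct phi -> bounded_fct psi ->
  bounded_fct (fun x => phi x + psi x).
Proof.
move=> [C phiC] [D psiD]; exists (C + D) => x.
by rewrite (le_trans (ler_normD _ _))// lerD.
Qed.

Lemma bounded_scale (a : R) phi : bounded_fct phi ->
  bounded_fct (fun x => a * phi x).
Proof.
by move=> [C phiC]; exists (`|a| * C) => x; rewrite normrM ler_wpM2l.
Qed.

Lemma bounded_comp phi (k : gT -> gT) : bounded_fct phi ->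
  bounded_fct (fun x => phi (k x)).
Proof. by move=> [C phiC]; exists C => x. Qed.

Lemma mean_norm_le m phi (C : R) : is_mean m -> (forall x, `|phi x| <= C) ->
  `|m phi| <= C.
Proof.
move=> mm phiC; have bphi : bounded_fct phi by exists C.
have mC : m (fun=> C) = C.
  by have := mean_scale mm C (bounded_cst 1); rewrite (mean_one mm) !mulr1.
have half (a : R) : `|a| = 1 -> a * m phi <= C.
  move=> a1; rewrite -subr_ge0 -{1}mC -mulNr -(mean_scale mm)//.
  rewrite -(mean_add mm); [|exact: bounded_cst|exact: bounded_scale].
  apply: (mean_ge0 mm).
    by apply: bounded_add; [exact: bounded_cst|exact: bounded_scale].
  move=> x; rewrite mulNr subr_ge0 (le_trans (ler_norm _))//.
  by rewrite normrM a1 mul1r.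
rewrite ler_norml; apply/andP; split; last first.
  by rewrite -[m phi]mul1r half ?normr1.
by rewrite lerNl -mulN1r half ?normrN1.
Qed.


Definition almost_invariant_mean H (F : seq gT) (e : R) :
    set ((gT -> R) -> R) :=
  [set m | [/\ is_mean m, mean_concentrated_on H m &
    forall h phi (C : R), h \in F ->
    (forall x, `|phi x| <= C) -> `|m (fun x => phi (h * x)%g) - m phi| <= e * C]].

Lemma no_gap_almost_invariant H (F : seq gT) (e : R) : H 1%g -> ~ has_gap R H ->
  {subset F <= H} -> 0 < e -> almost_invariant_mean H F e !=set0.
Proof.
move=> H1 nogap FH e0.
have [w [A [w0 AH w1 wF]]] := no_gap_density H1 nogap FH e0.
exists (fun phi => \sum_(x <- A) w x * phi x); split; last exact: wF.
- split=> [phi psi _ _|a phi _||phi _ phi0].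
  + by rewrite -big_split; apply: eq_bigr => x _; rewrite mulrDr.
  + by rewrite mulr_sumr; apply: eq_bigr => x _; rewrite mulrCA.
  + by under eq_bigr do rewrite mulr1.
  + by apply: sumr_ge0 => x _; rewrite mulr_ge0.
- move=> phi psi _ _ eqH; rewrite big_seq [RHS]big_seq; apply: eq_bigr => x xA.
  by rewrite eqH//; exact: AH.
Qed.

(** The almost invariant means on [H] form a filter base, indexed by finite
    subsets of [H] and tolerances; a limit along an ultrafilter that contains it
    is invariant. *)
Lemma no_gap_mean H : H 1%g -> ~ has_gap R H ->
  exists m, [/\ is_mean m, mean_concentrated_on H m &
    forall h, H h -> mean_invariant m h].
Proof.
move=> H1 nogap.
pose D : set (seq gT * R) := [set i : seq gT * R | {subset i.1 <= H} /\ 0 < i.2].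
pose B (i : seq gT * R) := almost_invariant_mean H i.1 i.2.
have FF : Filter (filter_from D B).
  apply: filter_from_filter => [|[F e] [F' e'] [/= FH e0] [/= F'H e'0]].
    by exists ([::], 1); split.
  exists (F ++ F', Order.min e e').
    split=> /=; last by rewrite lt_min e0.
    by move=> x; rewrite mem_cat => /orP[/FH|/F'H].
  move=> m [mm mH mF]; split; split=> // h phi C hF phiC;
    have C0 : 0 <= C by apply: le_trans (phiC 1%g).
    apply: le_trans (mF h phi C _ phiC) _; first by rewrite mem_cat hF.
    by rewrite ler_wpM2r// ge_min lexx.
  apply: le_trans (mF h phi C _ phiC) _; first by rewrite mem_cat hF orbT.
  by rewrite ler_wpM2r// ge_min lexx orbT.
have PF : ProperFilter (filter_from D B).
  apply: filter_from_proper => -[F e] [/= FH e0].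
  exact: no_gap_almost_invariant.
have [U [ultraU FU]] := ultraFilterLemma PF.
have U_near F e : {subset F <= H} -> 0 < e -> U (almost_invariant_mean H F e).
  by move=> FH e0; apply: FU; exists (F, e).
have U_mean : U (almost_invariant_mean H [::] 1) by exact: U_near.
pose ev phi (m : (gT -> R) -> R) := m phi.
have cvg_ev phi : bounded_fct phi -> ev phi @ U --> ulim U (ev phi).
  move=> [C phiC]; apply: (@ulim_cvg R _ U _ _ C).
  by apply: filterS U_mean => m [mm _ _]; exact: mean_norm_le.
have ulim_eq phi psi : U [set m | ev phi m = ev psi m] -> bounded_fct psi ->
    ulim U (ev phi) = ulim U (ev psi).
  move=> eqU bpsi; apply: ulimE; apply: cvg_trans (cvg_ev _ bpsi).
  by apply: near_eq_cvg; apply: filterS eqU => m /= ->.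
exists (fun phi => ulim U (ev phi)); split.
- split=> [phi psi bphi bpsi|a phi bphi||phi bphi phi0].
  + apply: ulimE; apply: cvg_trans (cvgD (cvg_ev _ bphi) (cvg_ev _ bpsi)).
    apply: near_eq_cvg; apply: filterS U_mean => m [mm _ _].
    by rewrite /ev /= (mean_add mm).
  + apply: ulimE; apply: cvg_trans (cvgM (cvg_cst a) (cvg_ev _ bphi)).
    apply: near_eq_cvg; apply: filterS U_mean => m [mm _ _].
    by rewrite /ev /= (mean_scale mm).
  + apply: ulimE; apply: cvg_near_cst.
    by apply: filterS U_mean => m [mm _ _]; exact: mean_one.
  + apply: (cvgr_to_ge (cvg_ev _ bphi)).
    by apply: filterS U_mean => m [mm _ _]; exact: mean_ge0.
- move=> phi psi bphi bpsi eqH; apply: ulim_eq => //.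
  by apply: filterS U_mean => m [_ mH _]; exact: mH.
- move=> h Hh phi bphi; have bphi' := bounded_comp (fun x => h * x)%g bphi.
  apply/eqP; rewrite -subr_eq0 -normr_le0; apply/ler_addgt0Pr => e e0.
  rewrite add0r; have [C phiC] := bphi.
  have C0 : 0 <= C by apply: le_trans (phiC 1%g).
  have eC : 0 < e / (C + 1) by rewrite divr_gt0// ltr_wpDl.
  have close : `|ev (fun x => phi (h * x)%g) m - ev phi m| @[m --> U] -->
      `|ulim U (ev (fun x => phi (h * x)%g)) - ulim U (ev phi)|.
    by apply: cvg_norm; apply: cvgB; exact: cvg_ev.
  apply: (cvgr_to_le close).
  have : U (almost_invariant_mean H [:: h] (e / (C + 1))).
    by apply: U_near => // x; rewrite mem_seq1 => /eqP ->; exact/mem_set.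
  apply: filterS => m [_ _ /(_ h phi C (mem_head _ _) phiC)] /= mh.
  apply: (le_trans mh); rewrite mulrAC ler_pdivrMr ?ltr_wpDl//.
  by rewrite ler_wpM2l ?(ltW e0)// lerDl.
Qed.

End Means.

(** * Constructions of invariant means *)

Section MeanConstructions.
Variables (R : realType) (gT : groupType).
Implicit Types (H : set gT) (g h k x y : gT) (phi psi : gT -> R).
Implicit Types (m : (gT -> R) -> R).

Lemma mean_invariant1 m : mean_invariant m 1%g.
Proof. by move=> phi _; under eq_fun do rewrite mul1g. Qed.

Lemma mean_invariantM m g h :
  mean_invariant m g -> mean_invariant m h -> mean_invariant m (g * h)%g.
Proof.
move=> mg mh phi bphi; under eq_fun do rewrite -mulgA.
by rewrite (mh (fun x => phi (g * x)%g)) ?mg//; exact: bounded_comp.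
Qed.

Lemma mean_invariantV m g : mean_invariant m g -> mean_invariant m g^-1%g.
Proof.
move=> mg phi bphi; rewrite -(mg (fun x => phi (g^-1 * x)%g)).
  by under eq_fun do rewrite mulKg.
exact: bounded_comp.
Qed.

Lemma mean_conjugate H H' g m : (forall x, H x -> H' (g * x * g^-1)%g) ->
  (forall x, H' x -> H (g^-1 * x * g)%g) ->
  [/\ is_mean m, mean_concentrated_on H m & forall h, H h -> mean_invariant m h] ->
  exists m', [/\ is_mean m', mean_concentrated_on H' m' &
    forall h, H' h -> mean_invariant m' h].
Proof.
move=> HH' H'H [[mD mZ m1 m0] mH mI].
have bc phi := @bounded_comp R gT phi (fun x => g * x * g^-1)%g.
exists (fun phi => m (fun x => phi (g * x * g^-1)%g)); split.
- split=> [phi psi bphi bpsi|a phi bphi||phi bphi phi0].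
  + by apply: mD; exact: bc.
  + by apply: mZ; exact: bc.
  + exact: m1.
  + by apply: m0 => //; exact: bc.
- move=> phi psi bphi bpsi eqH; apply: mH => [||x Hx]; [exact: bc|exact: bc|].
  by apply: eqH; exact: HH'.
- move=> h H'h phi bphi; rewrite -[RHS](mI _ (H'H _ H'h)); last exact: bc.
  by congr m; apply/funext => x; rewrite !mulgA mulgV mul1g.
Qed.

(** The convolution of a mean on [H i] and of a mean invariant under the other
    subgroups: elements of the latter can be moved past [H i], on which the
    first mean is concentrated. *)
Lemma mean_commuting_product (I : eqType) (H : I -> set gT) (L : seq I) :
  uniq L ->
  {in L &, forall i j, i != j ->
    forall x y, H i x -> H j y -> (x * y = y * x)%g} ->
  (forall i, i \in L -> exists m,
    [/\ is_mean m, mean_concentrated_on (H i) m &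
      forall h, H i h -> mean_invariant m h]) ->
  exists m : (gT -> R) -> R,
    is_mean m /\ forall i h, i \in L -> H i h -> mean_invariant m h.
Proof.
elim: L => [_ _ _|i L IH /= /andP[iL uL] comm HL].
  exists (fun phi => phi 1%g); split=> //; split=> //.
have iLL j : j \in L -> j \in i :: L by rewrite in_cons => ->; rewrite orbT.
have [||j /iLL|m2 [m2m m2I]] := IH; [by []| |exact: HL|].
  by move=> j k /iLL jL /iLL kL; exact: comm.
have [m1 [m1m m1H m1I]] := HL i (mem_head _ _).
have binner phi : bounded_fct phi ->
    bounded_fct (fun x => m2 (fun y => phi (x * y)%g)).
  by move=> [C phiC]; exists C => x; apply: (mean_norm_le m2m).
have bc phi x := @bounded_comp R gT phi (fun y => x * y)%g.
exists (fun phi => m1 (fun x => m2 (fun y => phi (x * y)%g))); split.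
  split=> [phi psi bphi bpsi|a phi bphi||phi bphi phi0].
  - rewrite -(mean_add m1m) ?binner//; [|exact: binner|exact: binner].
    by congr m1; apply/funext => x; rewrite (mean_add m2m)//; exact: bc.
  - rewrite -(mean_scale m1m); last exact: binner.
    by congr m1; apply/funext => x; rewrite (mean_scale m2m)//; exact: bc.
  - by rewrite (mean_one m2m) (mean_one m1m).
  - apply: (mean_ge0 m1m) => [|x]; first exact: binner.
    by apply: (mean_ge0 m2m) => //; exact: bc.
move=> j h; rewrite inE => /orP[/eqP -> Hh|jL Hh] phi bphi.
  under eq_fun do under eq_fun do rewrite mulgA.
  by rewrite (m1I h Hh (fun x => m2 (fun y => phi (x * y)%g)))//; exact: binner.
apply: m1H => [||x Hx]; [|exact: binner|].
  exact: (binner (fun x => phi (h * x)%g) (bc _ _ bphi)).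
rewrite -(m2I j h jL Hh (fun y => phi (x * y)%g)); last exact: bc.
congr m2; apply/funext => y; congr phi; rewrite !mulgA; congr (_ * _)%g.
apply/esym/(comm i j) => //; [exact: mem_head|exact: iLL|].
by apply: contraNneq iL => ->.
Qed.

(** Extending by zero outside the bounded functions makes two translates equal
    as soon as they agree as means. *)
Definition translate_mean m g : (gT -> R) -> R :=
  fun phi => if `[< bounded_fct phi >] then m (fun x => phi (g * x)%g) else 0.

(** The average over the finitely many translates, which the group permutes. *)
Lemma mean_finite_orbit m : is_mean m -> finite_set (range (translate_mean m)) ->
  exists m', is_mean m' /\ forall g, mean_invariant m' g.
Proof.
move=> mm finO; set O := fset_set (range (translate_mean m)).
have OE mu : (mu \in O) = (mu \in range (translate_mean m)) by rewrite in_fset_set.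
have O0 : 0 < (size O)%:R :> R.
  rewrite ltr0n -/(#|` O|)%fset cardfs_gt0; apply/fset0Pn.
  by exists (translate_mean m 1%g); rewrite OE; apply/mem_set; exists 1%g.
have bc phi x := @bounded_comp R gT phi (fun y => x * y)%g.
have tr_mean mu : mu \in O -> exists g, forall phi, bounded_fct phi ->
    mu phi = m (fun x => phi (g * x)%g).
  rewrite OE => /set_mem[g _ <-]; exists g => phi bphi.
  by rewrite /translate_mean asboolT.
exists (fun phi => (size O)%:R^-1 * \sum_(mu <- O) mu phi); split.
  split=> [phi psi bphi bpsi|a phi bphi||phi bphi phi0].
  - rewrite -mulrDr -big_split; congr (_ * _); apply: eq_big_seq => mu /tr_mean[g E].
    rewrite !E// ?(mean_add mm)//; try exact: bc.
    exact: bounded_add.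
  - rewrite [RHS]mulrCA; congr (_ * _); rewrite mulr_sumr; apply: eq_big_seq => mu /tr_mean[g E].
    rewrite !E// ?(mean_scale mm)//; try exact: bc.
    exact: bounded_scale.
  - rewrite (eq_big_seq (fun=> 1)) => [|mu /tr_mean[g E]].
      by rewrite big_const_seq count_predT iter_addr_0 mulVf// gt_eqF.
    by rewrite E ?(mean_one mm)//; exact: bounded_cst.
  - rewrite mulr_ge0 ?invr_ge0 ?(ltW O0)// big_seq sumr_ge0// => mu /tr_mean[g E].
    by rewrite E//; apply: (mean_ge0 mm) => //; exact: bc.
move=> k phi bphi; congr (_ * _).
pose tr h (mu : (gT -> R) -> R) phi := mu (fun x => phi (h * x)%g).
have trK h : cancel (tr h) (tr h^-1%g).
  move=> mu; apply/funext => psi; rewrite /tr; congr mu.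
  by apply/funext => x; rewrite mulKg.
have trO h : [fset tr h mu | mu in O]%fset = O.
  have sub h' : ([fset tr h' mu | mu in O] `<=` O)%fset.
    apply/fsubsetP => _ /imfsetP[mu /= + ->]; rewrite !OE => /set_mem[g _ <-].
    apply/mem_set; exists (h' * g)%g => //; apply/funext => psi.
    rewrite /translate_mean /tr; have -> : bounded_fct (fun x => psi (h' * x)%g) =
        bounded_fct psi.
      apply/propext; split=> [|/(@bc _ h')//] [C psiC]; exists C => x.
      by rewrite -(mulVKg h' x).
    by case: ifP => // _; congr m; apply/funext => x; rewrite mulgA.
  apply/eqP; rewrite eqEfsubset sub/=; apply/fsubsetP => mu muO.
  apply/imfsetP; exists (tr h^-1%g mu) => /=.
    by apply: (fsubsetP (sub h^-1%g)); exact: in_imfset.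
  by have := trK h^-1%g mu; rewrite invgK.
by rewrite -[in RHS](trO k) big_imfset//= => mu mu' _ _; exact: (can_inj (trK k)).
Qed.

Lemma invariant_mean_amenable m : is_mean m ->
  (forall g, mean_invariant m g) -> amenable R gT.
Proof.
move=> mm mI; pose ind (A : set gT) x : R := (x \in A)%:R.
have bind A : bounded_fct (ind A).
  by exists 1 => x; rewrite /ind; case: (x \in A); rewrite ?normr1 ?normr0.
exists (fun A => m (ind A)); split.
- rewrite -(mean_one mm); congr m; apply/funext => x.
  by rewrite /ind in_setT.
- by move=> A; apply: (mean_ge0 mm) => // x; rewrite /ind ler0n.
- move=> A B AB; rewrite -(mean_add mm)//; congr m; apply/funext => x.
  rewrite /ind in_setU; have : x \notin A `&` B by rewrite AB in_set0.
  by rewrite in_setI; case: (x \in A); case: (x \in B); rewrite // ?addr0 ?add0r.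
- move=> g A; rewrite -(mI g (ind [set (g * x)%g | x in A]))//.
  congr m; apply/funext => x; rewrite /ind; congr (_%:R); congr nat_of_bool.
  apply/idP/idP => [/set_mem[y Ay /mulgI <-]|/set_mem Ax]; apply/mem_set => //.
  by exists x.
Qed.

End MeanConstructions.

(** * Averaging conjugates over a subgroup *)

Section ConjugateAveraging.
Variables (R : realType) (gT : groupType).
Implicit Types (H K : set gT) (g h k t x y : gT) (s : seq gT).

Record is_subgroup H : Prop := IsSubgroup {
  subgroup1 : H 1%g;
  subgroupM : forall x y, H x -> H y -> H (x * y)%g;
  subgroupV : forall x, H x -> H x^-1%g }.

(** The double coset of [x] is a free orbit of [H * K]: [p x] is the
    [H]-component of the element that carries a chosen representative to [x]. *)
Lemma product_coordinate H K : is_subgroup H -> is_subgroup K ->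
  (forall h k, H h -> K k -> (h * k = k * h)%g) ->
  (forall h, H h -> K h -> h = 1%g) ->
  exists p : gT -> gT, (forall x, H (p x)) /\
    forall h k x, H h -> K k -> p (h * k * x)%g = (h * p x)%g.
Proof.
move=> sH sK comm triv.
pose coset x := [set y | exists h k, [/\ H h, K k & x = (h * k * y)%g]].
pose rep x := xget 1%g (coset x).
have coset_eq h k x : H h -> K k -> coset (h * k * x)%g = coset x.
  move=> Hh Kk; apply/seteqP; split => y [h' [k' [Hh' Kk' E]]].
    exists (h^-1 * h')%g, (k^-1 * k')%g; split.
    - by apply: subgroupM => //; exact: subgroupV.
    - by apply: subgroupM => //; exact: subgroupV.
    - have C := comm _ _ (subgroupM sH (subgroupV sH Hh) Hh') (subgroupV sK Kk).
      rewrite !mulgA in C; rewrite -[LHS](mulKg (h * k)%g) E invgM !mulgA.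
      by rewrite C.
  exists (h * h')%g, (k * k')%g; split; [exact: subgroupM|exact: subgroupM|].
  by rewrite E !mulgA -[(h * h' * k)%g]mulgA (comm h')// !mulgA.
have repP x : coset x (rep x).
  by apply: (@xgetPex _ 1%g); exists x, 1%g, 1%g; rewrite !mul1g; split=> //;
    exact: subgroup1.
have [p pP] : {p : gT -> gT & forall x,
    H (p x) /\ exists2 k, K k & x = (p x * k * rep x)%g}.
  apply: (@choice _ _ (fun x h => H h /\ exists2 k, K k & x = (h * k * rep x)%g)).
  by move=> x; have [h [k [Hh Kk E]]] := repP x; exists h; split=> //; exists k.
exists p; split=> [x|h k x Hh Kk]; first by case: (pP x).
have [Hp [k1 Kk1 E1]] := pP x; have [Hp' [k2 Kk2]] := pP (h * k * x)%g.
rewrite /rep coset_eq// -/(rep x) {1}E1 !mulgA => /mulIg E2.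
set q := p (h * k * x)%g in Hp' E2 *.
have E3 : (h * p x = q * k2 * (k * k1)^-1)%g.
  by rewrite -E2 -[(h * k * _)%g]mulgA -(comm (p x) k)// mulgA -mulgA mulgK.
have E4 : (q^-1 * (h * p x))%g = 1%g.
  apply: triv.
    by apply: subgroupM => //; [exact: subgroupV|exact: subgroupM].
  rewrite E3 -mulgA mulKg; apply: subgroupM => //; apply: subgroupV => //.
  exact: subgroupM.
by rewrite -[RHS](mulVKg q) E4 mulg1.
Qed.

(** With [K = t H t^-1], the fibration of [product_coordinate] intertwines
    [h (t h^-1 t^-1)] with [h], and [h t h^-1 = h (t h^-1 t^-1) t]. *)
Lemma conj_average_opnorm H t s (c : R) : 0 <= c -> is_subgroup H ->
  (forall h k, H h -> H k -> (h * (t * k * t^-1) = (t * k * t^-1) * h)%g) ->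
  (forall h k, H h -> H k -> h = (t * k * t^-1)%g -> h = 1%g) ->
  {subset s <= H} -> contracts H s c ->
  opnorm_le (\sum_(h <- s) @left_regular R gT (h * t * h^-1)%g)
    (c * (size s)%:R).
Proof.
move=> c0 sH comm triv sHs sc.
pose K := [set x | exists2 k, H k & x = (t * k * t^-1)%g].
have sK : is_subgroup K.
  split.
  - by exists 1%g; [exact: subgroup1|rewrite mulg1 mulgV].
  - move=> _ _ [h Hh ->] [k Hk ->]; exists (h * k)%g; first exact: subgroupM.
    by rewrite !mulgA mulgVK.
  - move=> _ [h Hh ->]; exists h^-1%g; first exact: subgroupV.
    by rewrite !invgM invgK !mulgA.
have [|h Hh [k Hk E]|p [Hp pE]] := product_coordinate sH sK.
- by move=> h _ Hh [k Hk ->]; exact: comm.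
- exact: triv E.
have := @contracts_opnorm R gT H s c (fun h => h * (t * h^-1 * t^-1))%g p t
  c0 sc Hp.
under eq_bigr do rewrite !mulgA mulgVK.
apply=> h x /sHs /set_mem Hh; apply: pE => //.
by exists h^-1%g => //; exact: subgroupV.
Qed.

End ConjugateAveraging.

(** * Automorphisms of a rooted tree *)

Section TreeAutomorphisms.
Variable r : nat -> nat.
Implicit Types (u v w : vertex r) (f g h : tree_aut r).

Lemma mul_autE g h v : (g * h)%g v = g (h v). Proof. by []. Qed.
Lemma mulVg_aut g v : (g^-1)%g (g v) = v.
Proof. by rewrite -mul_autE mulVg. Qed.
Lemma mulgV_aut g v : g ((g^-1)%g v) = v.
Proof. by rewrite -mul_autE mulgV. Qed.
Lemma aut_inj g : injective g. Proof. exact: can_inj (mulVg_aut g). Qed.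

Lemma is_vertexP (s : seq nat) :
  reflect (forall i, (i < size s)%N -> (nth 0%N s i < r i)%N) (is_vertex r s).
Proof.
apply: (iffP forallP) => H i; last exact: H (ltn_ord i).
by move=> si; have := H (Ordinal si).
Qed.

Lemma prefix_vertex (s t : seq nat) : prefix s t -> is_vertex r t -> is_vertex r s.
Proof.
move=> /prefixP[q ->] /is_vertexP H; apply/is_vertexP => i si.
by have := H i; rewrite size_cat nth_cat si ltn_addr// => /(_ isT).
Qed.

Lemma vertex_nonroot v : (0 < size (val v))%N -> exists u, is_child u v.
Proof.
case: v => s; case/lastP: s => // s x sv _ /=.
have su : is_vertex r s by apply: prefix_vertex sv; exact: prefix_rcons.
by exists (exist _ s su), x.
Qed.

Lemma child_size u v : is_child u v -> size (val v) = (size (val u)).+1.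
Proof. by move=> [x ->]; rewrite size_rcons. Qed.

Lemma parent_unique u u' v : is_child u v -> is_child u' v -> u = u'.
Proof. by move=> [x E] [y]; rewrite E => /rcons_inj[uu' _]; exact: val_inj. Qed.

(** An automorphism could only reverse an edge by mapping a child and the
    parent of a vertex to the same place. *)
Lemma aut_level_child f n v : size (val v) = n ->
  size (val (f v)) = n /\ forall u, is_child u v -> is_child (f u) (f v).
Proof.
have [_ fadj froot] := aut_funP f.
elim: n v => [|n IH] v vn.
  have -> : v = Defs.root r by apply: val_inj; case: (val v) vn.
  rewrite froot; split=> // u /child_size; by [].
have [u uv] : exists u, is_child u v by apply: vertex_nonroot; rewrite vn.
have un : size (val u) = n by have := child_size uv; rewrite vn => -[].
have [fu_size child_fu] := IH u un.
have fuv : is_child (f u) (f v).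
  have [//|fvu] := (fadj u v).1 (or_introl uv).
  have [u0 u0u] : exists u0, is_child u0 u.
    by apply: vertex_nonroot; rewrite un -fu_size (child_size fvu).
  have /(@aut_inj f) E := parent_unique fvu (child_fu _ u0u).
  by have := child_size u0u; rewrite un -E vn => /eqP; rewrite ltn_eqF.
split=> [|u' u'v]; first by rewrite (child_size fuv) fu_size.
by rewrite (parent_unique u'v uv).
Qed.

Lemma aut_size f v : size (val (f v)) = size (val v).
Proof. by have [] := @aut_level_child f _ v erefl. Qed.

Lemma aut_child f u v : is_child u v -> is_child (f u) (f v).
Proof. by have [_] := @aut_level_child f _ v erefl; exact. Qed.

Lemma aut_subtree f v w : subtree v w -> subtree (f v) (f w).
Proof.
rewrite /subtree /=; move: {2}(size (val w)) (erefl (size (val w))) => n.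
elim: n w => [|n IH] w wn vw.
  have w0 : w = Defs.root r by apply: val_inj; case: (val w) wn.
  have v0 : v = Defs.root r.
    by apply: val_inj; move: vw; rewrite w0 /=; case: (val v).
  by rewrite w0 v0 prefix_refl.
have [u uw] : exists u, is_child u w by apply: vertex_nonroot; rewrite wn.
have [q wv] : exists q, val w = val v ++ q by exact/prefixP.
move: wv; case/lastP: q => [|q' y] wv.
  by have -> : w = v; [apply: val_inj; rewrite wv cats0|exact: prefix_refl].
have vu : subtree v u.
  case: (uw) => x; rewrite wv -rcons_cat => /rcons_inj[vu _].
  by rewrite /subtree /= -vu prefix_prefix.
have [z ->] := aut_child f uw.
apply: prefix_trans (prefix_rcons _ _); apply: IH => //.
by move: wn; rewrite (child_size uw) => -[].
Qed.

Lemma subtree_eq v w x : size (val v) = size (val w) ->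
  subtree v x -> subtree w x -> v = w.
Proof.
rewrite /subtree /= !prefixE => vw /eqP vx /eqP wx; apply: val_inj.
by apply: etrans (esym vx) (etrans _ wx); congr (take _ _).
Qed.

Lemma finite_level n : finite_set (@level r n).
Proof.
pose M := \max_(i < n) r i.
pose dec (t : n.-tuple 'I_M.+1) : vertex r :=
  xget (Defs.root r) [set v | val v = map val t].
apply: (@sub_finite_set _ _ (range dec)); last exact/finite_image/finite_finset.
move=> v vn; have vM x : x \in val v -> (x < M.+1)%N.
  move=> /(nthP 0%N)[i iv <-]; have /is_vertexP H := valP v.
  rewrite ltnS (leq_trans (ltnW (H i iv)))//.
  have iN : (i < n)%N by rewrite -vn.
  exact: (leq_bigmax (Ordinal iN)).
have sz : size (map (@inord M) (val v)) == n by rewrite size_map vn.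
exists (Tuple sz) => //; apply: xget_unique => /= [|w wE]; last first.
  apply: val_inj; apply: (etrans wE).
  by rewrite -map_comp map_id_in// => x /vM; exact: inordK.
by rewrite -map_comp map_id_in// => x /vM; exact: inordK.
Qed.

Hypothesis r2 : forall i, (2 <= r i)%N.

Lemma extend_vertex v n : (size (val v) <= n)%N ->
  exists2 w, level n w & subtree v w.
Proof.
move=> vn; have wP : is_vertex r (val v ++ nseq (n - size (val v)) 0%N).
  apply/is_vertexP => i _; rewrite nth_cat; case: (ltnP i (size (val v))) => iv.
    by have /is_vertexP := valP v; exact.
  by rewrite nth_nseq if_same (leq_trans _ (r2 i)).
exists (exist (fun s => is_vertex r s) _ wP); last exact: prefix_prefix.
by rewrite /level /= size_cat size_nseq subnKC.
Qed.

(** A vertex that is moved forces its descendants to move. *)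
Lemma aut_moves_levels f : f <> 1%g -> exists N, forall n, (N <= n)%N ->
  exists2 v, level n v & f v <> v.
Proof.
move=> f1; have [v fv] : exists v, f v <> v.
  apply: contrapT => /forallNP H; apply: f1; apply: tree_aut_eq => v.
  by apply: contrapT => /H.
exists (size (val v)) => n vn; have [w wn vw] := extend_vertex vn.
exists w => // fw; apply: fv; apply: (@subtree_eq _ _ w) => //.
  exact: aut_size.
by rewrite -fw; exact: aut_subtree.
Qed.

End TreeAutomorphisms.

(** * Rigid stabilizers *)

Section RigidStabilizers.
Variables (r : nat -> nat) (G : groupClosed (tree_aut r)).
Local Notation Gamma := (subgroup_type G).
Implicit Types (u v w x : vertex r) (g h t : Gamma).

(** The rigid stabilizer of [v] as a subset of the group [G] itself, over which
    the means and the operators are defined. *)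
Definition rist v : set Gamma := [set g | RiSt_vertex G v (val g)].

Lemma val_mulg g h : val (g * h)%g = (val g * val h)%g. Proof. by []. Qed.
Lemma val_invg g : val (g^-1)%g = (val g)^-1%g. Proof. by []. Qed.

Lemma ristP v g : rist v g <->
  val g v = v /\ forall w, ~ subtree v w -> val g w = w.
Proof. by split=> [[]|[gv gw]]; [|split=> //; exact: (valP g)]. Qed.

Lemma rist_subgroup v : is_subgroup (rist v).
Proof.
split.
- by apply/ristP.
- move=> g h /ristP[gv gw] /ristP[hv hw]; apply/ristP; rewrite val_mulg.
  split=> [|w vw]; first by rewrite mul_autE hv.
  by rewrite mul_autE hw// gw.
- move=> g /ristP[gv gw]; apply/ristP; rewrite val_invg; split=> [|w vw].
    by rewrite -{1}gv mulVg_aut.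
  by rewrite -{1}(gw w vw) mulVg_aut.
Qed.

Lemma rist_conj v t g : rist v g -> rist (val t v) (t * g * t^-1)%g.
Proof.
move=> /ristP[gv gw]; apply/ristP; rewrite !val_mulg val_invg.
split=> [|w vw]; rewrite !mul_autE ?mulVg_aut ?gv//.
rewrite gw ?mulgV_aut// => H; apply: vw.
by have := aut_subtree (val t) H; rewrite mulgV_aut.
Qed.

Lemma rist_fix v w g : size (val v) = size (val w) -> rist v g -> val g w = w.
Proof.
move=> vw /ristP[gv gw]; have [vw'|] := pselect (subtree v w); last exact: gw.
suff -> : w = v by [].
by apply/esym/(subtree_eq vw vw'); exact: prefix_refl.
Qed.

Lemma rist_commute v w g h : size (val v) = size (val w) -> v <> w ->
  rist v g -> rist w h -> (g * h = h * g)%g.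
Proof.
move=> vw neq /ristP[gv gw] /ristP[hv hw].
apply: val_inj; apply: tree_aut_eq => x; rewrite !val_mulg !mul_autE.
have [vx|nvx] := pselect (subtree v x).
  have fixh y : subtree v y -> val h y = y.
    by move=> vy; apply: hw => wy; apply: neq; exact: subtree_eq vy wy.
  rewrite !fixh//.
  by have := aut_subtree (val g) vx; rewrite gv.
rewrite (gw x nvx); have [wx|nwx] := pselect (subtree w x).
  rewrite gw// => vhx; apply: neq; apply: subtree_eq vhx _ => //.
  by have := aut_subtree (val h) wx; rewrite hv.
by rewrite (hw x nwx) gw.
Qed.

Lemma rist_disjoint v w g : size (val v) = size (val w) -> v <> w ->
  rist v g -> rist w g -> g = 1%g.
Proof.
move=> vw neq /ristP[_ gv] /ristP[_ gw].
apply: val_inj; apply: tree_aut_eq => x.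
have [vx|] := pselect (subtree v x); last exact: gv.
by apply: gw => wx; apply: neq; exact: subtree_eq vx wx.
Qed.

(** * Groups with a gap in every rigid stabilizer *)

Section Averaging.
Variable R : realType.
Implicit Types (s : seq Gamma) (e : R).

Lemma rist_gap_opnorm v e : has_gap R (rist v) -> 0 < e ->
  exists s, [/\ s != [::], {subset s <= rist v} &
    forall t, val t v <> v ->
    opnorm_le (\sum_(h <- s) @left_regular R Gamma (h * t * h^-1)%g)
      (e * (size s)%:R)].
Proof.
move=> gap e0; have sub := rist_subgroup v.
have [s [s0 sH sc]] := has_gap_small (subgroupM sub) gap e0.
exists s; split=> // t tv.
have vt : size (val v) = size (val (val t v)) by rewrite aut_size.
apply: (conj_average_opnorm (ltW e0) sub) sc => // [h k Hh Hk|h k Hh Hk E].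
  apply: (rist_commute vt) => //; first by move=> /esym.
  exact: rist_conj.
apply: (rist_disjoint vt) Hh _; first by move=> /esym.
by rewrite E; exact: rist_conj.
Qed.

(** Conjugating [t] by the rigid stabilizer of a vertex of level [n] does not
    change how it permutes the vertices of level [n], so that the averages for
    the vertices in [L] can be performed one after the other. *)
Lemma level_gap_opnorm n (L : seq (vertex r)) e : 0 < e ->
  (forall v, v \in L -> level n v /\ has_gap R (rist v)) ->
  exists2 s, s != [::] & forall t v, v \in L -> val t v <> v ->
    opnorm_le (\sum_(h <- s) @left_regular R Gamma (h * t * h^-1)%g)
      (e * (size s)%:R).
Proof.
move=> e0; elim: L => [_|v L IH HL]; first by exists [:: 1%g].
have [|s' s'0 s'P] := IH; first by move=> w wL; apply: HL; rewrite in_cons wL orbT.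
have [vn gap] := HL v (mem_head _ _).
have [s [s0 sH sP]] := rist_gap_opnorm gap e0.
exists [seq (a * b)%g | a <- s', b <- s].
  by rewrite -size_eq0 size_allpairs muln_eq0 !size_eq0 negb_or s'0.
move=> t w; rewrite in_cons => /orP[/eqP -> tv|wL tw].
  rewrite big_allpairs_dep size_allpairs natrM.
  have -> : e * ((size s')%:R * (size s)%:R) =
      \sum_(a <- s') e * (size s)%:R.
    by rewrite big_const_seq count_predT iter_addr_0 -mulr_natr; ring.
  apply: opnorm_le_sum => a _.
  have -> : \sum_(b <- s) @left_regular R Gamma (a * b * t * (a * b)^-1)%g =
      left_regular a \o (\sum_(b <- s) left_regular (b * t * b^-1)%g)
        \o left_regular a^-1%g.
    apply/funext => xi /=; rewrite !sum_opE linear_sum; apply: eq_bigr => b _.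
    have -> : (a * b * t * (a * b)^-1 = a * (b * t * b^-1 * a^-1))%g.
      by rewrite invgM !mulgA.
    by rewrite left_regularM [in LHS]left_regularM.
  by apply: (@opnorm_le_conj R Gamma a); [rewrite mulr_ge0 ?(ltW e0)|exact: sP].
rewrite big_allpairs_dep exchange_big size_allpairs natrM.
have -> : e * ((size s')%:R * (size s)%:R) =
    \sum_(b <- s) e * (size s')%:R.
  by rewrite big_const_seq count_predT iter_addr_0 -mulr_natr; ring.
rewrite big_seq [X in opnorm_le _ X]big_seq; apply: opnorm_le_sum => b bs.
have conjE a : (a * b * t * (a * b)^-1 = a * (b * t * b^-1) * a^-1)%g.
  by rewrite invgM !mulgA.
under eq_bigr do rewrite conjE.
have [|wn _] := HL w; first by rewrite in_cons wL orbT.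
apply: s'P wL _; rewrite !val_mulg val_invg !mul_autE.
have bfix x : size (val x) = n -> val b x = x.
  move=> xn; apply: rist_fix (set_mem (sH _ bs)).
  by rewrite xn; exact: vn.
have -> : (val b)^-1%g w = w by rewrite -{1}(bfix w wn) mulVg_aut.
by rewrite bfix// aut_size.
Qed.

End Averaging.
(** * Groups with a rigid stabilizer without gap *)

Section Amenability.
Variable R : realType.
Hypothesis hG : branch_group G.

Lemma level_transitive_gamma n v w : level n v -> level n w ->
  exists t, val t v = w.
Proof.
move=> vn wn; have [t tG tv] := hG.1 n v w vn wn.
by exists (exist (fun a : tree_aut r => a \in G) t tG).
Qed.

(** [v] having no spectral gap, its rigid stabilizer carries an invariant mean,
    and so do its conjugates, which are the rigid stabilizers of all the other
    vertices of the level. *)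
Lemma no_gap_level_mean n v : level n v -> ~ has_gap R (rist v) ->
  exists m : (Gamma -> R) -> R, is_mean m /\
    forall w h, level n w -> rist w h -> mean_invariant m h.
Proof.
move=> vn nogap; have [m0 m0P] := no_gap_mean (subgroup1 (rist_subgroup v)) nogap.
pose L := fset_set (@level r n).
have LE w : (w \in L) = (w \in @level r n) by rewrite in_fset_set//; exact: finite_level.
have [||w wL|m [mm mI]] := @mean_commuting_product R Gamma _ rist L.
- exact: fset_uniq.
- move=> u w; rewrite !LE => /set_mem un /set_mem wn /eqP neq x y.
  by apply: rist_commute neq; rewrite un wn.
- move: wL; rewrite LE => /set_mem wn.
  have [t tv] := level_transitive_gamma vn wn.
  apply: (@mean_conjugate R Gamma (rist v) (rist w) t m0) => // h.
    by rewrite -tv; exact: rist_conj.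
  rewrite -{1}(invgK t) => /(rist_conj t^-1%g).
  by rewrite invgK val_invg -tv mulVg_aut.
exists m; split=> // w h wn; apply: mI; rewrite LE; exact/mem_set.
Qed.

Lemma invariant_RiSt n (m : (Gamma -> R) -> R) :
  (forall w h, level n w -> rist w h -> mean_invariant m h) ->
  forall h, RiSt G n (val h) -> mean_invariant m h.
Proof.
move=> mI h; pose I := [set g : tree_aut r |
  exists2 h : Gamma, val h = g & mean_invariant m h].
have : RiSt G n `<=` I.
  apply: smallest_sub => [|g [w wn gw]].
    split=> [|x y /set_mem[g <- mg] /set_mem[k <- mk]]; apply/mem_set.
      by exists 1%g => //; exact: mean_invariant1.
    by exists (g * k^-1)%g => //; apply: mean_invariantM => //; exact: mean_invariantV.
  have [gG _ _] := gw.
  by exists (exist (fun a : tree_aut r => a \in G) g gG) => //; exact: mI wn _.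
by move=> sub /sub[k /val_inj ->].
Qed.

(** A translate of [m] by [g] is determined by the action of [g] on level [n] and
    by a coset of [RiSt n] in [St n], and there are finitely many of both. *)
Lemma finite_orbit_of_RiSt_invariant n (m : (Gamma -> R) -> R) : (1 <= n)%N ->
  is_mean m -> (forall h, RiSt G n (val h) -> mean_invariant m h) ->
  finite_set (range (translate_mean m)).
Proof.
move=> n1 mm mI; pose C := [set [set (x * h)%g | h in RiSt G n] | x in St G n].
have finC : finite_set C := hG.2 n n1.
pose L : seq (vertex r) := fset_set (@level r n).
have LE w : (w \in L) = (w \in @level r n) by rewrite in_fset_set//; exact: finite_level.
(* The action of [g] on level [n], as an element of a finite type. *)
pose code g : {ffun 'I_(size L) -> 'I_(size L).+1} :=
  [ffun i : 'I_(size L) => inord (index (val g (nth (Defs.root r) L i)) L)].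
have codeP g h w : code g = code h -> level n w -> val g w = val h w.
  move=> E wn; have wL : w \in L by rewrite LE; exact/mem_set.
  have iw : (index w L < size L)%N by rewrite index_mem.
  have gn (k : Gamma) : size (val (val k w)) = n by rewrite aut_size; exact: wn.
  have gL (k : Gamma) : val k w \in L by rewrite LE; apply/mem_set; exact: gn.
  have := congr1 (fun f : {ffun 'I_(size L) -> 'I_(size L).+1} =>
    val (f (Ordinal iw))) E.
  rewrite !ffunE /= nth_index// !inordK ?ltnS ?index_size// => ii.
  by rewrite -[LHS](nth_index (Defs.root r) (gL g)) ii nth_index ?gL.
pose rep z := xget 1%g [set g | code g = z].
pose coset (x : tree_aut r) := [set (x * h)%g | h in RiSt G n].
pose crep (c : set (tree_aut r)) := xget 1%g [set g : Gamma | coset (val g) = c].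
pose D := [set: {ffun 'I_(size L) -> 'I_(size L).+1}] `*` C.
apply: (@sub_finite_set _ _
    ((fun zc => translate_mean m (rep zc.1 * crep zc.2)%g) @` D)).
  move=> _ [g _ <-]; set y := rep (code g).
  have yE : code y = code g by apply: (@xgetPex _ 1%g [set h | code h = code g]); exists g.
  set x := (y^-1 * g)%g; exists (code g, coset (val x)).
    split=> //; exists (val x) => //; split; first exact: (valP x).
    move=> w wn; rewrite val_mulg mul_autE -(codeP y g w yE wn) val_invg.
    exact: mulVg_aut.
  rewrite /= -/y; set x' := crep _.
  have x'E : coset (val x') = coset (val x).
    by apply: (@xgetPex _ 1%g [set g : Gamma | coset (val g) = _]); exists x.
  have [k kn kE] : coset (val x') (val x).
    rewrite x'E; exists 1%g; last by rewrite mulg1.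
    by move=> H [[/set_mem]].
  have gE : g = (y * x' * (x'^-1 * x))%g by rewrite -mulgA mulVKg mulVKg.
  rewrite [in RHS]gE; apply/funext => phi; rewrite /translate_mean.
  case: asboolP => // bphi.
  under [in RHS]eq_fun do rewrite -mulgA.
  rewrite (mI _ _ (fun z => phi (y * x' * z)%g))//; last exact: bounded_comp.
  by rewrite val_mulg val_invg -kE mulKg.
apply: finite_image; apply: finite_setX => //; exact: finite_finset.
Qed.

Lemma no_gap_amenable n v : (1 <= n)%N -> level n v ->
  ~ has_gap R (rist v) -> amenable R Gamma.
Proof.
move=> n1 vn nogap; have [m [mm mI]] := no_gap_level_mean vn nogap.
have fin := finite_orbit_of_RiSt_invariant n1 mm (invariant_RiSt mI).
have [m' [m'm m'I]] := mean_finite_orbit mm fin.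
exact: invariant_mean_amenable m'm m'I.
Qed.

End Amenability.

Lemma gap_Cstar_simple (R : realType) : (forall i, (2 <= r i)%N) ->
  (forall n v, (1 <= n)%N -> level n v -> has_gap R (rist v)) ->
  Cstar_simple R Gamma.
Proof.
move=> r2 gap; apply: powers_averaging_Cstar_simple => F e F1 e0.
have [N NP] : exists N, forall n, (N <= n)%N -> forall t, t \in F ->
    exists2 v, level n v & val t v <> v.
  elim: F F1 => [_|t F IH]; first by exists 0%N.
  rewrite in_cons negb_or => /andP[t1 /IH[N NP]].
  have [N' N'P] : exists N', forall n, (N' <= n)%N ->
      exists2 v, level n v & val t v <> v.
    by apply: aut_moves_levels => // E; case/eqP: t1; apply/esym/val_inj.
  exists (maxn N N') => n; rewrite geq_max => /andP[Nn N'n] s.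
  by rewrite in_cons => /orP[/eqP ->|]; [exact: N'P|exact: NP].
have [|s s0 sP] := @level_gap_opnorm R N.+1 (fset_set (@level r N.+1)) e e0.
  move=> v; rewrite in_fset_set; last exact: finite_level.
  by move=> /set_mem vN; split=> //; exact: (gap N.+1).
exists s => // t tF; have [v vN tv] := NP N.+1 (leqnSn N) t tF.
by apply: sP tv; rewrite in_fset_set; [exact/mem_set|exact: finite_level].
Qed.

End RigidStabilizers.

Theorem theorem1p12 (R : realType) (r : nat -> nat)
    (hr : forall i : nat, (2 <= r i)%N) (G : groupClosed (tree_aut r))
    (hG : branch_group G) (hcount : countable [set: subgroup_type G]) :
  amenable R (subgroup_type G) \/ Cstar_simple R (subgroup_type G).
Proof.
have [gap|] := pselect (forall n v, (1 <= n)%N -> level n v ->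
    has_gap R (@rist r G v)).
  by right; exact: gap_Cstar_simple.
move=> /existsNP[n] /existsNP[v] /not_implyP[n1] /not_implyP[vn nogap].
by left; exact: no_gap_amenable hG n v n1 vn nogap.
Qed.
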